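(* Suppose the standing assumptions (1)–(6) listed in the context hold and, additionally, that there exists $C\ge1$ (not depending on $g$) such that $\bar\pi_{g,0}=C\,\pi_{g,0}$ for all $1\le g\le G$. Then for any sequence (indexed by $m\ge1$) of random weight functions $\widehat W$ such that $\widehat W:[0,1]\to\widehat K$ and $\widehat G_{\widehat W}$ is nondecreasing, $$\lim_{m\to\infty}\mathrm{Pow}(\mathrm{ADDOW})\ \ge\ \limsup_{m\to\infty}\mathrm{Pow}\big(\mathrm{MWBH}(\widehat W)\big),$$ where the limit on the left exists.
   Context: Setting. Fix an integer $G\ge2$. For each $m$ one tests $m$ null hypotheses split into $G$ groups of sizes $m_1,\dots,m_G$ (nondecreasing integer sequences depending on $m$, $\sum_g m_g=m$). In group $g$, $H_{g,1},\dots,H_{g,m_g}\in\{0,1\}$ are fixed ($H_{g,i}=0$: the null is true), and the $p$-values $p_{g,1},\dots,p_{g,m_g}$ are $[0,1]$-valued random variables. Let $m_{g,1}=\sum_i H_{g,i}$, $m_{g,0}=m_g-m_{g,1}$, and $U(x)=\mathbf 1\{x>0\}\min(x,1)$. All limits are as $m\to\infty$. Standing assumptions: (1) if $H_{g,i}=0$, $p_{g,i}$ is uniform on $[0,1]$; (2) if $H_{g,i}=1$, $p_{g,i}$ has c.d.f. $F_g$ (not depending on $i$ or $m$), strictly concave on $[0,1]$, with $F_g(0)=0$; (3) there are $\pi_g>0$, $\pi_{g,0}>0$ with $m_g/m\to\pi_g$, $m_{g,0}/m_g\to\pi_{g,0}$, and $\pi_{g,1}=1-\pi_{g,0}>0$,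 for each $g$; (4) weak dependence: for each $g$ and $t\ge0$, in probability, $\frac1{m_{g,0}}\sum_{i}\mathbf 1\{p_{g,i}\le t,H_{g,i}=0\}\to U(t)$ and $\frac1{m_{g,1}}\sum_{i}\mathbf 1\{p_{g,i}\le t,H_{g,i}=1\}\to F_g(t)$ (no assumption on dependence across groups); (5) for each $g$ there is an estimator (random variable) $\hat\pi_{g,0}\in(0,1]$ with $\hat\pi_{g,0}\to\bar\pi_{g,0}$ in probability for some constant $\bar\pi_{g,0}\ge\pi_{g,0}$; (6) the target level satisfies $\alpha\in(\alpha^*,1)$, where $$\alpha^*=\inf_{w\in K^\infty}\frac1{\sum_g\pi_gw_g(\pi_{g,0}+\pi_{g,1}f_g(0^+))},\qquad K^\infty=\Big\{w\in\mathbb R_+^G:\sum_g\pi_g\bar\pi_{g,0}w_g\le1\Big\},$$ $f_g(0^+)=\lim_{x\to0^+}(F_g(x)-F_g(0))/x\in[0,\infty]$ (conventions $1/\infty=0$, $1/0=\infty$, $0\cdot\infty=0$). Procedures. For nondecreasing $h:[0,1]\to[0,1]$ with $h(0)=0$, $\mathcal I(h)=\sup\{u\in[0,1]:h(u)\ge u\}$. For a (possibly random) weight function $W:[0,1]\to\mathbb R_+^G$ (a vector $w$ is viewed as a constant function), $$\widehat G_W(u)=m^{-1}\sum_{g=1}^G\sum_{i=1}^{m_g}\mathbf 1\{p_{g,i}\le\alpha uW_g(u)\}.$$ If $\widehat G_W$ is nondecreasing, let $\hat u_W=\mathcal I(\widehat G_W)$ and $\mathrm{MWBH}(W)=\{(g,i):p_{g,i}\le\alpha\hat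 u_WW_g(\hat u_W)\}$ (set of rejected indices). Let $\widehat K=\{w\in\mathbb R_+^G:\sum_g\frac{m_g}m\hat\pi_{g,0}w_g\le1\}$. Fix any random function $\widehat W^*:[0,1]\to\widehat K$ with $\widehat G_{\widehat W^*}(u)=\max_{w\in\widehat K}\widehat G_w(u)$ for all $u\in[0,1]$ (such a maximum exists, $\widehat G_{\widehat W^*}$ is nondecreasing, and the results do not depend on the choice; random functions are understood to be such that the quantities considered are measurable). $\mathrm{ADDOW}=\mathrm{MWBH}(\widehat W^* )$. Criterion. For a procedure $R$ (random set of rejected indices) and $\mathcal H_1=\{(g,i):H_{g,i}=1\}$, $\mathrm{Pow}(R)=m^{-1}\mathbb E\big[|R\cap\mathcal H_1|\big]$. *)

(* Defs.v *)
From HB Require Import structures.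
From mathcomp Require Import all_boot all_order all_algebra.
From mathcomp Require Import all_classical all_reals all_analysis.
Import Order.TTheory GRing.Theory Num.Theory.
Import numFieldNormedType.Exports.

Set Implicit Arguments.
Unset Strict Implicit.
Unset Printing Implicit Defensive.

Local Open Scope classical_set_scope.
Local Open Scope ring_scope.

Definition strictly_concave_on (R : realType) (A : set R) (f : R -> R) : Prop :=
  forall x y t : R, A x -> A y -> x != y -> 0 < t < 1 ->
    (1 - t) * f x + t * f y < f ((1 - t) * x + t * y).

Definition cvg_in_probability (d : measure_display) (T : measurableType d)
    (R : realType) (P : probability T R) (X : nat -> T -> R) (l : R) : Prop :=
  forall eps : R, 0 < eps ->
    P [set w | eps <= `|X n w - l|] @[n --> \oo] --> (0 : \bar R).

Definition is_maximum (R : realType) (A : set R) (x : R) : Prop :=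
  A x /\ ubound A x.

Definition unif_cdf (R : realType) (x : R) : R := (0 < x)%R%:R * Num.min x 1.

(* I(h).  The set is bounded, and contains 0 as soon as h 0 >= 0, so the default
   value of sup plays no role. *)
Definition crossing (R : realType) (h : R -> R) : R :=
  sup [set u | 0 <= u <= 1 /\ u <= h u].

(* Nonnegative weight vectors with c-weighted sum at most 1.  The oracle set
   K^oo is the case c_g = pi_g * bar-pi_{g,0}, the empirical set \hat K the
   case c_g = (m_g / m) * \hat pi_{g,0}. *)
Definition weight_space (R : realType) (G : nat) (c : 'I_G -> R) :
    set 'rV[R]_G :=
  [set w | (forall g, 0 <= w 0 g) /\ \sum_(g < G) c g * w 0 g <= 1].

(* f(0^+), in \bar R since it may be infinite; for F concave on [0, 1] the limit
   exists, so lim does not return its default value. *)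
Definition slope0 (R : realType) (F : R -> R) : \bar R :=
  lim (((F x - F 0) / x)%:E @[x --> (0 : R)^'+]).

(* The inverse and the product are those of \bar R, for which
   0^-1 = +oo, (+oo)^-1 = 0 and 0 * +oo = 0. *)
Definition alpha_star (R : realType) (G : nat) (piG pi0 pibar : 'I_G -> R)
    (F : 'I_G -> R -> R) : \bar R :=
  ereal_inf [set ((\sum_(g < G) (piG g * w 0 g)%R%:E *
                    ((pi0 g)%:E + (1 - pi0 g)%R%:E * slope0 (F g)))^-1)%E
            | w in weight_space (fun g => piG g * pibar g)].

Definition hyp (G : nat) (ms : 'I_G -> nat) : finType := {g : 'I_G & 'I_(ms g)}.

Definition n_alt (n : nat) (H : 'I_n -> bool) : nat := (\sum_(i < n) H i)%N.

Definition n_null (n : nat) (H : 'I_n -> bool) : nat := (n - n_alt H)%N.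

Definition alternatives (G : nat) (ms : 'I_G -> nat)
    (H : forall g, 'I_(ms g) -> bool) : {set hyp ms} :=
  [set h : hyp ms | H (tag h) (tagged h)].

(* In the next three definitions, p and W are one realization of the family of
   p-values and of the weight function; only the values of W on [0, 1] are
   relevant. *)
Definition Ghat (R : realType) (G m : nat) (ms : 'I_G -> nat) (alpha : R)
    (p : forall g, 'I_(ms g) -> R) (W : R -> 'rV[R]_G) (u : R) : R :=
  m%:R^-1 * \sum_(g < G) \sum_(i < ms g) (p g i <= alpha * u * W u 0 g)%R%:R.

Definition uhat (R : realType) (G m : nat) (ms : 'I_G -> nat) (alpha : R)
    (p : forall g, 'I_(ms g) -> R) (W : R -> 'rV[R]_G) : R :=
  crossing (Ghat m alpha p W).

Definition MWBH (R : realType) (G m : nat) (ms : 'I_G -> nat) (alpha : R)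
    (p : forall g, 'I_(ms g) -> R) (W : R -> 'rV[R]_G) : {set hyp ms} :=
  [set h : hyp ms | p (tag h) (tagged h) <=
     alpha * uhat m alpha p W * W (uhat m alpha p W) 0 (tag h)].

Definition true_rejections (d : measure_display) (T : measurableType d)
    (R : realType) (G : nat) (ms : 'I_G -> nat)
    (H : forall g, 'I_(ms g) -> bool) (D : T -> {set hyp ms}) (w : T) : R :=
  #|D w :&: alternatives H|%:R.

Definition Pow (d : measure_display) (T : measurableType d) (R : realType)
    (P : probability T R) (G m : nat) (ms : 'I_G -> nat)
    (H : forall g, 'I_(ms g) -> bool) (D : T -> {set hyp ms}) : \bar R :=
  ((m%:R^-1)%:E * 'E_P[true_rejections R H D])%E.

(* Main.v *)
Require Import Defs.
From HB Require Import structures.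
From mathcomp Require Import all_boot all_order all_algebra.
From mathcomp Require Import all_classical all_reals all_analysis.
From mathcomp Require Import measurable_realfun.
From mathcomp Require Import ring lra.
Import Order.TTheory GRing.Theory Num.Theory.
Import numFieldNormedType.Exports.
Local Open Scope classical_set_scope.
Local Open Scope ring_scope.

(* In the limit, choosing weights at level [u] amounts to choosing thresholds
   [t_g = alpha u w_g] with [C * sum_g a_g t_g <= alpha u], where
   [a_g = pi_g pi_{g,0}] and [b_g = pi_g pi_{g,1}]; the procedure then makes
   [sum_g a_g U(t_g)] null and [sum_g b_g F_g(t_g)] true discoveries.  Because
   [pibar_{g,0} = C pi_{g,0}], the constraint bounds precisely the null
   discoveries, by [B(u) = min(alpha u / C, sum_g a_g)], and any allocation can
   be enlarged until it exhausts this bound.  So a maximizer of the total number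
   of discoveries also maximizes the true ones: if [M(u)] is the maximal number
   of true discoveries, ADDOW makes about [B(u) + M(u)] discoveries at its own
   level [u], at most [B(u)] of them null, hence about [M(u)] true ones.  Any
   competitor has a smaller level and [M] is nondecreasing.  The level of ADDOW
   converges because the maximal total is concave in [u] and [alpha > alpha^*]
   puts it above the diagonal somewhere. *)

Set Implicit Arguments.
Unset Strict Implicit.
Unset Printing Implicit Defensive.

(** * Concave distribution functions *)

Section concave_cdf.
Context {R : realType}.
Implicit Types (f e : R -> R).

(** Thresholds [alpha u w_g] may exceed 1, so concavity is asked on the whole half line. Together
    with subadditivity, the limit at 0 makes small increments uniformly small. *)
Record concave_cdf f : Prop := ConcaveCdf {
  cdf_at0 : f 0 = 0 ;
  cdf_at1 : forall x, 1 <= x -> f x = 1 ;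
  cdf_homo : forall x y, 0 <= x -> x <= y -> f x <= f y ;
  cdf_concave : forall x y t, 0 <= x -> 0 <= y -> 0 <= t <= 1 ->
    (1 - t) * f x + t * f y <= f ((1 - t) * x + t * y) ;
  cdf_cvg0 : f x @[x --> 0^'+] --> (0 : R) }.

Lemma concave_cdf_ge0 f x : concave_cdf f -> 0 <= x -> 0 <= f x.
Proof. by move=> cf x0; rewrite -(cdf_at0 cf); exact: (cdf_homo cf). Qed.

Lemma concave_cdf_le1 f x : concave_cdf f -> 0 <= x -> f x <= 1.
Proof.
move=> cf x0; rewrite -(cdf_at1 cf (x := Num.max x 1)) ?le_max ?lexx ?orbT//.
by apply: (cdf_homo cf) => //; rewrite le_max lexx.
Qed.

Lemma concave_cdf_scale f x t : concave_cdf f -> 0 <= x -> 0 <= t <= 1 ->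
  t * f x <= f (t * x).
Proof.
move=> cf x0 t01; have := cdf_concave cf (lexx 0) x0 t01.
by rewrite cdf_at0// !mulr0 !add0r.
Qed.

Lemma concave_cdf_trunc f x : concave_cdf f -> f (Num.min x 1) = f x.
Proof.
move=> cf; case: (leP x 1) => // /ltW x1.
by rewrite (cdf_at1 cf x1) (cdf_at1 cf).
Qed.

(** Scaling keeps at least the fraction [1 - t] of [f x], and [f x <= 1] bounds what is lost. The
    loss does not depend on [x], so arbitrarily large thresholds are covered. *)
Lemma concave_cdf_scale_le f x t : concave_cdf f -> 0 <= x -> 0 <= t <= 1 ->
  f x <= f ((1 - t) * x) + t.
Proof.
move=> cf x0 /andP[t0 t1].
have := @concave_cdf_scale f x (1 - t) cf x0; have := concave_cdf_le1 cf x0.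
have := concave_cdf_ge0 cf x0.
by move=> f0 f1 /(_ ltac:(apply/andP; split; lra)); nra.
Qed.

(** Both [x] and [y - x] are multiples of [y], by factors that sum to 1; scaling towards 0 applies
    to each. *)
Lemma concave_cdf_subadditive f x y : concave_cdf f -> 0 <= x -> x <= y ->
  f y <= f x + f (y - x).
Proof.
move=> cf x0 xy; have [y0|y0] := eqVneq y 0.
  have -> : x = 0 by lra.
  by rewrite y0 subr0 cdf_at0// addr0.
have yp : 0 < y by rewrite lt_def y0 (le_trans x0 xy).
have t01 : 0 <= x / y <= 1.
  by rewrite divr_ge0 ?(ltW yp)//= ler_pdivrMr ?mul1r.
have s01 : 0 <= 1 - x / y <= 1 by lra.
have := concave_cdf_scale cf (ltW yp) t01.
have := concave_cdf_scale cf (ltW yp) s01.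
rewrite [(1 - x / y) * y]mulrBl !divfK// mul1r; lra.
Qed.

Lemma unif_cdfE (x : R) : 0 <= x -> unif_cdf x = Num.min x 1.
Proof.
rewrite /unif_cdf le_eqVlt => /predU1P[<-|->]; last by rewrite mul1r.
by rewrite ltxx mul0r minEle ler01.
Qed.

Lemma unif_cdf_concave : concave_cdf (@unif_cdf R).
Proof.
have E := unif_cdfE.
have minR (x : R) y : Num.min x y = x \/ Num.min x y = y.
  by rewrite minEle; case: ifP; [left|right].
split.
- by rewrite E// minEle ler01.
- by move=> x x1; rewrite E ?(le_trans ler01)//; apply/min_idPr.
- move=> x y x0 xy; rewrite !E ?(le_trans x0)//.
  by rewrite le_min !ge_min xy lexx /= orbT.
- move=> x y t x0 y0 /andP[t0 t1].
  rewrite !E//; last by rewrite addr_ge0// mulr_ge0// subr_ge0.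
  have: Num.min x 1 <= x by rewrite ge_min lexx.
  have: Num.min x 1 <= 1 by rewrite ge_min lexx orbT.
  have: Num.min y 1 <= y by rewrite ge_min lexx.
  have: Num.min y 1 <= 1 by rewrite ge_min lexx orbT.
  move: (Num.min x 1) (Num.min y 1) => a b b1 bY a1 ax.
  by rewrite le_min; apply/andP; split; nra.
- apply/cvgrPdist_le => eps eps0; near=> x.
  rewrite E ?sub0r ?normrN; last by near: x; exact: nbhs_right_ge.
  have x0 : 0 < x by near: x; exact: nbhs_right_gt.
  rewrite ger0_norm ?le_min ?(ltW x0)//= ge_min; apply/orP; left.
  by near: x; apply: nbhs_right_le.
Unshelve. all: by end_near. Qed.

(** Since [f] factors through the concave function [min(x, 1)] and is nondecreasing, concavity
    extends from [[0, 1]] to the half line. *)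
Lemma strictly_concave_on_concave_cdf f : strictly_concave_on `[0, 1] f ->
  f 0 = 0 -> (forall x, 1 <= x -> f x = 1) -> {homo f : x y / x <= y} ->
  f x @[x --> 0^'+] --> (0 : R) -> concave_cdf f.
Proof.
move=> fc f0 f1 fh fcvg; split => //; first by move=> x y _; exact: fh.
move=> x y t x0 y0 /andP[t0 t1].
have fE z : f z = f (Num.min z 1).
  by case: (leP z 1) => // /ltW z1; rewrite !f1.
have min01 (z : R) : 0 <= z -> `[0, 1]%classic (Num.min z 1).
  by move=> z0; rewrite /= in_itv/= le_min z0 ler01 ge_min lexx orbT.
have minx (z : R) : Num.min z 1 <= z by rewrite ge_min lexx.
rewrite (fE x) (fE y).
apply: (@le_trans _ _ (f ((1 - t) * Num.min x 1 + t * Num.min y 1))); last first.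
  by apply: fh; apply: lerD; apply: ler_wpM2l => //; rewrite subr_ge0.
(* Truncation may merge the two points. This case and the weights 0 and 1 fall outside strict
   concavity and are equalities. *)
have [->|xy] := eqVneq (Num.min x 1) (Num.min y 1).
  by rewrite -!mulrDl subrK !mul1r.
have [->|tn0] := eqVneq t 0; first by rewrite !mul0r !addr0 subr0 !mul1r.
have [->|tn1] := eqVneq t 1; first by rewrite subrr !mul0r !add0r !mul1r.
apply/ltW/fc => //; [exact: min01|exact: min01|].
by rewrite !lt_neqAle eq_sym tn0 tn1 t0 t1.
Qed.

(* Polya's form of the Glivenko-Cantelli argument; by subadditivity, the
   increments of [f] over the grid are at most [f (1 / K)]. *)
Lemma grid_approx f e a eta (K : nat) : concave_cdf f -> (0 < K)%N -> 0 <= a ->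
  (forall x y, 0 <= x -> x <= y -> e x <= e y) ->
  (forall x, 1 <= x -> e x = e 1) ->
  a * f K%:R^-1 <= eta ->
  (forall k : 'I_K.+1, `|e (k%:R / K%:R) - a * f (k%:R / K%:R)| <= eta) ->
  forall t, 0 <= t -> `|e t - a * f t| <= eta + eta.
Proof.
move=> cf K0 a0 eh e1 fK grid t t0.
have KR : (0 : R) < K%:R by rewrite ltr0n.
have eta0 : 0 <= eta by exact: le_trans (normr_ge0 _) (grid ord0).
have [t1|t1] := leP 1 t.
  have := grid ord_max; rewrite /= divff ?gt_eqF// -(e1 t)// (cdf_at1 cf (x := 1))//.
  by rewrite (cdf_at1 cf t1) => /le_trans; apply; lra.
(* The cell from [k / K] to [(k + 1) / K] contains [t]; monotonicity traps [e t] between the values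
   of [e] at its endpoints. *)
pose k := Num.truncn (t * K%:R).
have /andP[kt tk] : k%:R <= t * K%:R < k.+1%:R.
  by apply: truncn_itv; rewrite mulr_ge0// ltW.
have kK : (k < K)%N by rewrite -(ltr_nat R); nra.
have := grid (inord k.+1); have := grid (inord k).
rewrite !inordK ?ltnS ?(ltnW kK)// => g1 g2.
have x0 : (0 : R) <= k%:R / K%:R by rewrite divr_ge0// ltW.
have xt : k%:R / K%:R <= t by rewrite ler_pdivrMr.
have ty : t <= k.+1%:R / K%:R by rewrite ler_pdivlMr// ltW.
have yE : k.+1%:R / K%:R = k%:R / K%:R + K%:R^-1 :> R.
  by rewrite -natr1 mulrDl mul1r.
move: g1 g2 x0 xt ty; rewrite yE; set x := k%:R / K%:R; set h := K%:R^-1.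
move=> g1 g2 x0 xt ty.
have h0 : 0 <= h by rewrite invr_ge0 ltW.
have ex := eh _ _ x0 xt; have ey := eh _ _ t0 ty.
have fx := concave_cdf_subadditive cf x0 xt.
have fy := concave_cdf_subadditive cf t0 ty.
have th : f (t - x) <= f h by apply: (cdf_homo cf); lra.
have ht : f (x + h - t) <= f h by apply: (cdf_homo cf); lra.
move: g1 g2; rewrite !ler_norml => /andP[g11 g12] /andP[g21 g22].
by apply/andP; split; nra.
Qed.

End concave_cdf.

(** * Optimal allocations in the limit *)

Section crossing.
Context {R : realType}.
Implicit Types h k : R -> R.

Let crossing_set h := [set u | 0 <= u <= 1 /\ u <= h u].

Let has_sup_crossing h : 0 <= h 0 -> has_sup (crossing_set h).
Proof.
move=> h0; split; first by exists 0; split; rewrite ?lexx ?ler01.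
by exists 1 => u [/andP[]].
Qed.

Lemma crossing_ge h u : 0 <= h 0 -> 0 <= u <= 1 -> u <= h u -> u <= crossing h.
Proof. by move=> h0 u01 uh; apply: ub_le_sup => //; case: (has_sup_crossing h0). Qed.

Lemma crossing_le h x : 0 <= h 0 ->
  (forall u, 0 <= u <= 1 -> u <= h u -> u <= x) -> crossing h <= x.
Proof.
move=> h0 hx; apply: ge_sup; first by case: (has_sup_crossing h0).
by move=> u [u01 uh]; exact: hx.
Qed.

Lemma crossing01 h : 0 <= h 0 -> 0 <= crossing h <= 1.
Proof.
move=> h0; rewrite crossing_ge ?lexx ?ler01//= crossing_le// => u.
by case/andP.
Qed.

Lemma le_crossing h k : 0 <= h 0 -> (forall u, 0 <= u <= 1 -> h u <= k u) ->
  crossing h <= crossing k.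
Proof.
move=> h0 hk; have k0 : 0 <= k 0 by rewrite (le_trans h0)// hk// lexx ler01.
apply: crossing_le => // u u01 uh.
by apply: crossing_ge => //; rewrite (le_trans uh)// hk.
Qed.

End crossing.

Section allocation.
Context {R : realType} {G : nat}.
Variables (a b : 'I_G -> R) (F : 'I_G -> R -> R) (C alpha : R).
Hypotheses (a_gt0 : forall g, 0 < a g) (b_gt0 : forall g, 0 < b g).
Hypothesis ab1 : \sum_g (a g + b g) = 1.
Hypotheses (C_gt0 : 0 < C) (alpha_gt0 : 0 < alpha).
Hypothesis F_cdf : forall g, concave_cdf (F g).
Implicit Types (u : R) (s t : 'I_G -> R).

(* [t g] stands for the threshold [alpha * u * w_g] of group [g]. *)
Definition feasible u t :=
  (forall g, 0 <= t g) /\ C * \sum_g a g * t g <= alpha * u.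
Definition nulls t := \sum_g a g * unif_cdf (t g).
Definition alts t := \sum_g b g * F g (t g).
Definition max_alts u := sup [set alts t | t in feasible u].
Definition budget u := Num.min (alpha * u / C) (\sum_g a g).

Let U_cdf := @unif_cdf_concave R.

Lemma feasible_scale u t x : feasible u t -> 0 <= x ->
  feasible (x * u) (fun g => x * t g).
Proof.
move=> [t0 tu] x0; split=> [g|]; first exact: mulr_ge0.
rewrite (eq_bigr (fun g => x * (a g * t g))); last by move=> g _; ring.
by rewrite -mulr_sumr mulrCA [leRHS]mulrCA ler_wpM2l.
Qed.

Lemma feasible_le u v t : u <= v -> feasible u t -> feasible v t.
Proof. by move=> uv [t0 tu]; split => //; rewrite (le_trans tu)// ler_pM2l. Qed.

Lemma feasible_ge0 u t : feasible u t -> 0 <= u.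
Proof.
move=> [t0 tu]; rewrite -(pmulr_rge0 _ alpha_gt0) (le_trans _ tu)//.
by rewrite mulr_ge0 ?(ltW C_gt0)// sumr_ge0// => g _; rewrite mulr_ge0 ?(ltW (a_gt0 g)).
Qed.

Lemma feasible_convex u v s t x : feasible u s -> feasible v t -> 0 <= x <= 1 ->
  feasible ((1 - x) * u + x * v) (fun g => (1 - x) * s g + x * t g).
Proof.
move=> [s0 su] [t0 tv] /andP[x0 x1]; split=> [g|].
  by rewrite addr_ge0// mulr_ge0// subr_ge0.
rewrite (eq_bigr (fun g => (1 - x) * (a g * s g) + x * (a g * t g))); last first.
  by move=> g _; ring.
by rewrite big_split/= -!mulr_sumr; nra.
Qed.

Lemma sum_a_le1 : \sum_g a g <= 1.
Proof. by rewrite -ab1; apply: ler_sum => g _; rewrite lerDl ltW. Qed.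

Lemma sum_b_le1 : \sum_g b g <= 1.
Proof. by rewrite -ab1; apply: ler_sum => g _; rewrite lerDr ltW. Qed.

Lemma nulls_trunc t : nulls (fun g => Num.min (t g) 1) = nulls t.
Proof. by apply: eq_bigr => g _; rewrite concave_cdf_trunc. Qed.

Lemma alts_trunc t : alts (fun g => Num.min (t g) 1) = alts t.
Proof. by apply: eq_bigr => g _; rewrite concave_cdf_trunc. Qed.

Lemma alts_ge0 t : (forall g, 0 <= t g) -> 0 <= alts t.
Proof.
by move=> t0; apply: sumr_ge0 => g _; rewrite mulr_ge0 ?concave_cdf_ge0 ?(ltW (b_gt0 g)).
Qed.

Lemma alts_le1 t : (forall g, 0 <= t g) -> alts t <= 1.
Proof.
move=> t0; apply: le_trans sum_b_le1; apply: ler_sum => g _.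
by rewrite ler_piMr ?concave_cdf_le1 ?(ltW (b_gt0 g)).
Qed.

Lemma alts_homo s t : (forall g, 0 <= s g) -> (forall g, s g <= t g) ->
  alts s <= alts t.
Proof.
move=> s0 st; apply: ler_sum => g _; rewrite ler_wpM2l ?(ltW (b_gt0 g))//.
exact: (cdf_homo (F_cdf g)).
Qed.

(** The bound [U(x) <= x] turns the weight constraint into [alpha u / C]; the bound [U <= 1] gives
    the total null mass. *)
Lemma nulls_le_budget u t : feasible u t -> nulls t <= budget u.
Proof.
move=> [t0 tu]; rewrite le_min; apply/andP; split.
  rewrite ler_pdivlMr// mulrC (le_trans _ tu)// ler_pM2l//.
  by apply: ler_sum => g _; rewrite ler_pM2l// unif_cdfE// ge_min lexx.
by apply: ler_sum => g _; rewrite ler_piMr ?(ltW (a_gt0 g))// concave_cdf_le1.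
Qed.

Lemma alts_le_max u t : feasible u t -> alts t <= max_alts u.
Proof.
move=> ft; apply: ub_le_sup; last by exists t.
by exists 1 => _ [s [s0 _] <-]; exact: alts_le1.
Qed.

Lemma feasible0 u : 0 <= u -> feasible u (fun=> 0).
Proof.
move=> u0; split=> //; rewrite big1 => [|g _]; last by rewrite mulr0.
by rewrite mulr0 mulr_ge0// ltW.
Qed.

Lemma max_alts_le u x : 0 <= u ->
  (forall t, feasible u t -> alts t <= x) -> max_alts u <= x.
Proof.
move=> u0 H; apply: ge_sup.
  by exists (alts (fun=> 0)), (fun=> 0) => //; exact: feasible0.
by move=> _ [t ft <-]; exact: H.
Qed.

Lemma max_alts_homo u v : 0 <= u -> u <= v -> max_alts u <= max_alts v.
Proof.
move=> u0 uv; apply: max_alts_le => // t ft.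
exact/alts_le_max/(feasible_le uv).
Qed.

Lemma max_alts_le1 u : 0 <= u -> max_alts u <= 1.
Proof. by move=> u0; apply: max_alts_le => // t [t0 _]; exact: alts_le1. Qed.

Lemma max_alts0 : max_alts 0 = 0.
Proof.
have alts0 : alts (fun=> 0) = 0.
  by apply: big1 => g _; rewrite (cdf_at0 (F_cdf g)) mulr0.
apply/eqP; rewrite eq_le; apply/andP; split; last first.
  by rewrite -[leLHS]alts0; apply/alts_le_max/feasible0.
apply: max_alts_le => // t [t0]; rewrite mulr0 pmulr_rle0// => tu.
have tg g : t g = 0.
  have : a g * t g <= 0.
    apply: le_trans tu; rewrite (bigD1 g)//= lerDl sumr_ge0// => i _.
    by rewrite mulr_ge0// ltW.
  by rewrite pmulr_rle0// => tg; apply/eqP; rewrite eq_le tg t0.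
by rewrite /alts big1// => g _; rewrite tg (cdf_at0 (F_cdf g)) mulr0.
Qed.

Lemma alts_scale t x : (forall g, 0 <= t g) -> 0 <= x <= 1 ->
  x * alts t <= alts (fun g => x * t g).
Proof.
move=> t0 x01; rewrite mulr_sumr; apply: ler_sum => g _.
by rewrite mulrCA ler_pM2l// concave_cdf_scale.
Qed.

(** Scaling an allocation at level [v] by [u / v] makes it feasible at [u] and, by concavity, keeps
    at least that fraction of its true discoveries. As these are at most 1, the loss is at most
    [1 - u / v]. *)
Lemma max_alts_lipschitz w u v : 0 < w -> 0 <= u -> u <= v -> w <= v ->
  max_alts v <= max_alts u + (v - u) / w.
Proof.
move=> w0 u0 uv wv; have v0 : 0 < v by exact: lt_le_trans wv.
have x01 : 0 <= u / v <= 1 by rewrite divr_ge0 ?(ltW v0)//= ler_pdivrMr// mul1r.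
apply: max_alts_le => [|t ft]; first exact: ltW.
have t0 := ft.1.
have := alts_scale t0 x01.
have : alts (fun g => u / v * t g) <= max_alts u.
  apply: alts_le_max; have /andP[x0 _] := x01.
  by have := feasible_scale ft x0; rewrite divfK// gt_eqF.
have := alts_le1 t0; have := alts_ge0 t0.
have : 1 - u / v <= (v - u) / w.
  rewrite -[X in X - _](divff (lt0r_neq0 v0)) -mulrBl ler_wpM2l ?subr_ge0//.
  by rewrite lef_pV2.
by move=> /= A B D E H; move: x01 A B D E H; move: (u / v) ((v - u) / w) => x y *; nra.
Qed.

(* Optimality of the total number of rejections already forces the null
   rejections to exhaust the budget, so it is also optimal for [alts]. *)
Lemma feasible_saturate u s : feasible u s ->
  exists2 t, feasible u t & budget u + alts s <= nulls t + alts t.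
Proof.
move=> fs; have [s0 su] := fs.
(* On [[0, 1]] the uniform distribution function is the identity, so null discoveries become linear
   in the thresholds. *)
pose s' g := Num.min (s g) 1.
have s'0 g : 0 <= s' g by rewrite le_min s0 ler01.
have s'1 g : s' g <= 1 by rewrite ge_min lexx orbT.
have s'E : nulls s' = \sum_g a g * s' g.
  by apply: eq_bigr => g _; rewrite unif_cdfE//; congr (_ * _); apply/min_idPl.
have Sb : \sum_g a g * s' g <= budget u.
  by rewrite -s'E nulls_trunc; exact: nulls_le_budget.
(* Move from [s'] towards the allocation with all thresholds 1, whose null mass is [sum_g a_g],
   until the budget is met exactly. If both null masses agree, [s'] already meets it. *)
have [x /andP[x0 x1] xE] : exists2 x : R, 0 <= x <= 1 &
    (1 - x) * (\sum_g a g * s' g) + x * \sum_g a g = budget u.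
  have bA : budget u <= \sum_g a g by rewrite ge_min lexx orbT.
  move: Sb bA; move: (budget u) (\sum_g a g * s' g) (\sum_g a g) => B S A SB BA.
  have [AS|AS] := eqVneq (A - S) 0.
    by exists 0; rewrite ?lexx ?ler01// subr0 mul1r mul0r addr0; lra.
  have AS0 : 0 < A - S by rewrite lt_def AS; lra.
  exists ((B - S) / (A - S)).
    by rewrite divr_ge0 ?subr_ge0 ?(le_trans SB)//= ler_pdivrMr// mul1r lerB.
  set y := (B - S) / (A - S).
  have -> : (1 - y) * S + y * A = S + y * (A - S) by ring.
  by rewrite divfK// addrC subrK.
pose t g := (1 - x) * s' g + x.
have s't g : s' g <= t g by rewrite /t; have := s'1 g; nra.
have t0 g : 0 <= t g by exact: le_trans (s't g).
have t1 g : t g <= 1 by rewrite /t; have := s'1 g; nra.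
have tE : \sum_g a g * t g = budget u.
  rewrite -xE !mulr_sumr -big_split /=; apply: eq_bigr => g _; rewrite /t; ring.
exists t.
  split => //; rewrite tE mulrC -ler_pdivlMr//.
  by rewrite ge_min lexx.
rewrite -[alts s]alts_trunc; apply: lerD; last exact: alts_homo.
rewrite -tE le_eqVlt; apply/orP; left; apply/eqP/eq_bigr => g _.
by rewrite unif_cdfE//; congr (_ * _); apply/esym/min_idPl.
Qed.

Definition discoveries t := nulls t + alts t.

Lemma discoveries_sum t :
  discoveries t = \sum_g (a g * unif_cdf (t g) + b g * F g (t g)).
Proof. by rewrite big_split. Qed.

Lemma discoveries_concave s t x : (forall g, 0 <= s g) -> (forall g, 0 <= t g) ->
  0 <= x <= 1 ->
  (1 - x) * discoveries s + x * discoveries t <=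
    discoveries (fun g => (1 - x) * s g + x * t g).
Proof.
move=> s0 t0 x01; rewrite !discoveries_sum !mulr_sumr -big_split.
apply: ler_sum => g _ /=.
have := cdf_concave U_cdf (s0 g) (t0 g) x01.
have := cdf_concave (F_cdf g) (s0 g) (t0 g) x01.
by have := a_gt0 g; have := b_gt0 g; nra.
Qed.

(** The estimated constraint differs from the limiting one by a factor close to 1, so slightly
    shrunk thresholds become feasible. This and the next two lemmas bound the cost by [x], as the
    masses sum to at most 1. *)
Lemma nulls_shrink t x : (forall g, 0 <= t g) -> 0 <= x <= 1 ->
  nulls t <= nulls (fun g => (1 - x) * t g) + x.
Proof.
move=> t0 x01; have /andP[x0 _] := x01.
apply: (@le_trans _ _ (nulls (fun g => (1 - x) * t g) + x * \sum_g a g)).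
  rewrite mulr_sumr -big_split /=; apply: ler_sum => g _.
  by have := concave_cdf_scale_le U_cdf (t0 g) x01; have := a_gt0 g; nra.
by rewrite lerD2l ler_piMr// sum_a_le1.
Qed.

Lemma alts_shrink t x : (forall g, 0 <= t g) -> 0 <= x <= 1 ->
  alts t <= alts (fun g => (1 - x) * t g) + x.
Proof.
move=> t0 x01; have /andP[x0 _] := x01.
apply: (@le_trans _ _ (alts (fun g => (1 - x) * t g) + x * \sum_g b g)).
  rewrite mulr_sumr -big_split /=; apply: ler_sum => g _.
  by have := concave_cdf_scale_le (F_cdf g) (t0 g) x01; have := b_gt0 g; nra.
by rewrite lerD2l ler_piMr// sum_b_le1.
Qed.

Lemma discoveries_shrink t x : (forall g, 0 <= t g) -> 0 <= x <= 1 ->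
  discoveries t <= discoveries (fun g => (1 - x) * t g) + x.
Proof.
move=> t0 x01; have /andP[x0 _] := x01.
apply: (@le_trans _ _ (discoveries (fun g => (1 - x) * t g) + x * \sum_g (a g + b g))).
  rewrite !discoveries_sum mulr_sumr -big_split /=; apply: ler_sum => g _.
  have := concave_cdf_scale_le (F_cdf g) (t0 g) x01; have := b_gt0 g.
  by have := concave_cdf_scale_le U_cdf (t0 g) x01; have := a_gt0 g; nra.
by rewrite ab1 mulr1.
Qed.

(* The strict inequality makes the supremum reachable by fixed allocations: no
   maximizer has to exist. *)
Definition supercritical u := exists2 t, feasible u t & u < discoveries t.
Definition oracle_level := sup [set u | 0 <= u <= 1 /\ supercritical u].

Hypothesis supercritical_ex : exists2 u, 0 <= u <= 1 & supercritical u.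

Let has_sup_level : has_sup [set u | 0 <= u <= 1 /\ supercritical u].
Proof.
split; last by exists 1 => u [/andP[]].
by have [u] := supercritical_ex; exists u.
Qed.

Lemma le_oracle_level u : 0 <= u <= 1 -> supercritical u -> u <= oracle_level.
Proof. by move=> u01 su; apply: ub_le_sup => //; case: has_sup_level. Qed.

(** At level 0 the budget and [max_alts] are at most 0, which leaves no positive number of
    discoveries. *)
Lemma supercritical_gt0 u : supercritical u -> 0 < u.
Proof.
move=> [t ft ut]; have := feasible_ge0 ft; rewrite le_eqVlt => /predU1P[u0|//].
move: ft ut; rewrite -u0 => ft; rewrite ltNge => /negP[].
have : alts t <= 0 by rewrite -max_alts0; exact: alts_le_max.
have := nulls_le_budget ft; rewrite /budget mulr0 mul0r /discoveries.
have : Num.min 0 (\sum_g a g) <= 0 by rewrite ge_min lexx.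
lra.
Qed.

Lemma oracle_level_gt0 : 0 < oracle_level.
Proof.
have [u u01 su] := supercritical_ex.
exact: lt_le_trans (supercritical_gt0 su) (le_oracle_level u01 su).
Qed.

Lemma oracle_level_le1 : oracle_level <= 1.
Proof. by apply: ge_sup => [|u [/andP[]]//]; case: has_sup_level. Qed.

Lemma oracle_level_approx eps : 0 < eps -> exists2 u, 0 <= u <= 1 &
  supercritical u /\ oracle_level - eps < u.
Proof.
move=> e0; have [u [u01 su] ul] := sup_adherent e0 has_sup_level.
by exists u.
Qed.

(* Otherwise, mixing [t] with a little of a supercritical allocation would give
   a supercritical level above the supremum. *)
Lemma discoveries_gap eps : 0 < eps -> exists2 delta, 0 < delta &
  forall u t, oracle_level + eps <= u <= 1 -> feasible u t ->
    discoveries t <= u - delta.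
Proof.
move=> e0; have [u0 u001 [t0 ft0 ut0]] := supercritical_ex.
have u0l := le_oracle_level u001 (ex_intro2 _ _ _ ft0 ut0).
have u0p : 0 < u0 by apply: supercritical_gt0; exists t0.
(* Levels lie in [[0, 1]], so mixing with weight at most [eps / 2] lowers [u] by at most [eps / 2]
   and the mixed level stays above the supremum. *)
pose x := Num.min (eps / 2) 1.
have x0 : 0 < x by rewrite lt_min ltr01 divr_gt0.
have x1 : x <= 1 by rewrite ge_min lexx orbT.
have xe : x <= eps / 2 by rewrite ge_min lexx.
have x01 : 0 <= x <= 1 by rewrite (ltW x0).
(* This is the surplus that [t0] brings to the mixture; if [t] missed its level by less than this,
   the mixture would be supercritical. *)
exists (x * (discoveries t0 - u0)); first by rewrite mulr_gt0// subr_gt0.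
move=> u t /andP[lu u1] ft; rewrite leNgt; apply/negP => tt.
have /andP[u00 u01] := u001.
have ft' := feasible_convex ft ft0 x01.
have := discoveries_concave ft.1 ft0.1 x01.
set v := (1 - x) * u + x * u0 in ft' *; set t' := fun g => _ in ft' *.
move=> tc; have : v <= oracle_level.
  apply: le_oracle_level; first by rewrite /v; apply/andP; split; nra.
  by exists t' => //; rewrite /v; nra.
by rewrite /v; nra.
Qed.

End allocation.

(** * Comparison on a fixed sample *)

Section empirical.
Context {R : realType} {G : nat}.
Variables (a b : 'I_G -> R) (F : 'I_G -> R -> R) (C alpha : R).
Hypotheses (a_gt0 : forall g, 0 < a g) (b_gt0 : forall g, 0 < b g).
Hypothesis ab1 : \sum_g (a g + b g) = 1.
Hypotheses (C_gt0 : 0 < C) (alpha_gt0 : 0 < alpha).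
Hypothesis F_cdf : forall g, concave_cdf (F g).

(** This isolates what is needed of a sample, so that the comparison is deterministic. The error on
    [c] is multiplicative because feasibility is transferred by rescaling thresholds. *)
Record close_to_limit (eta : R) (e0 e1 : 'I_G -> R -> R) (c : 'I_G -> R) : Prop :=
  CloseToLimit {
  e0_ge0 : forall g x, 0 <= e0 g x ;
  e1_ge0 : forall g x, 0 <= e1 g x ;
  e0_close : forall g x, 0 <= x -> `|e0 g x - a g * unif_cdf x| <= eta ;
  e1_close : forall g x, 0 <= x -> `|e1 g x - b g * F g x| <= eta ;
  c_close : forall g, (1 - eta) * (C * a g) <= c g <= (1 + eta) * (C * a g) }.

Definition weighted (u : R) (v : 'rV[R]_G) (g : 'I_G) : R := alpha * u * v 0 g.

Definition emp_total (e0 e1 : 'I_G -> R -> R) (u : R) (v : 'rV[R]_G) : R :=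
  \sum_g (e0 g (weighted u v g) + e1 g (weighted u v g)).

Section fixed_sample.
Variables (eta : R) (e0 e1 : 'I_G -> R -> R) (c : 'I_G -> R).
Hypotheses (eta01 : 0 < eta < 1) (closeE : close_to_limit eta e0 e1 c).

Let eta_ge0 : 0 <= eta. Proof. by case/andP: eta01 => /ltW. Qed.
Let eta_le1 : 0 <= eta <= 1. Proof. by case/andP: eta01 => /ltW -> /ltW ->. Qed.

Lemma weighted_ge0 u v g : 0 <= u -> weight_space c v -> 0 <= weighted u v g.
Proof. by move=> u0 [v0 _]; rewrite !mulr_ge0// ltW. Qed.

(** The factor [1 - eta] compensates for [c g] being possibly as small as [(1 - eta) C a_g]. *)
Lemma weighted_feasible u v : 0 <= u -> weight_space c v ->
  feasible a C alpha u (fun g => (1 - eta) * weighted u v g).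
Proof.
move=> u0 cv; have [v0 cv1] := cv; split=> [g|].
  by rewrite mulr_ge0 ?weighted_ge0//; case/andP: eta01; lra.
apply: (@le_trans _ _ (alpha * u * \sum_(g < G) c g * v 0 g)); last first.
  by rewrite ler_piMr// mulr_ge0// ltW.
rewrite !mulr_sumr; apply: ler_sum => g _; rewrite /weighted.
rewrite (_ : C * _ = alpha * u * ((1 - eta) * (C * a g) * v 0 g)); last by ring.
rewrite ler_wpM2l ?mulr_ge0 ?(ltW alpha_gt0)// ler_wpM2r//.
by case/andP: (c_close closeE g).
Qed.

Lemma sum_close (e f : 'I_G -> R) : (forall g, `|e g - f g| <= eta) ->
  `|\sum_g e g - \sum_g f g| <= G%:R * eta.
Proof.
move=> ef; rewrite -sumrB (le_trans (ler_norm_sum _ _ _))//.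
apply: le_trans (ler_sum _ (fun g _ => ef g)) _.
by rewrite sumr_const card_ord mulr_natl.
Qed.

(** The error is [eta] for each of the [G] groups, plus [eta] for shrinking the thresholds to
    feasibility. Totals involve two functions per group, whence [2G + 1] further on. *)
Lemma emp_alts_le u v : 0 <= u -> weight_space c v ->
  \sum_g e1 g (weighted u v g) <= max_alts a b F C alpha u + (G.+1)%:R * eta.
Proof.
move=> u0 cv; have w0 g := weighted_ge0 g u0 cv.
have := sum_close (fun g => e1_close closeE g (w0 g)).
have := alts_shrink a_gt0 b_gt0 ab1 F_cdf w0 eta_le1.
have := alts_le_max a_gt0 b_gt0 ab1 F_cdf (weighted_feasible u0 cv).
rewrite /alts -natr1 mulrDl mul1r ler_norml => A B /andP[_ D]; lra.
Qed.

Lemma emp_nulls_le u v : 0 <= u -> weight_space c v ->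
  \sum_g e0 g (weighted u v g) <= budget a C alpha u + (G.+1)%:R * eta.
Proof.
move=> u0 cv; have w0 g := weighted_ge0 g u0 cv.
have := sum_close (fun g => e0_close closeE g (w0 g)).
have := nulls_shrink a_gt0 b_gt0 ab1 w0 eta_le1.
have := nulls_le_budget a_gt0 C_gt0 (weighted_feasible u0 cv).
rewrite /nulls -natr1 mulrDl mul1r ler_norml => A B /andP[_ D]; lra.
Qed.

Lemma emp_total_le u v : 0 <= u -> weight_space c v ->
  exists2 t, feasible a C alpha u t &
    emp_total e0 e1 u v <= discoveries a b F t + (G.*2.+1)%:R * eta.
Proof.
move=> u0 cv; have w0 g := weighted_ge0 g u0 cv.
exists (fun g => (1 - eta) * weighted u v g); first exact: weighted_feasible.
have := sum_close (fun g => e0_close closeE g (w0 g)).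
have := sum_close (fun g => e1_close closeE g (w0 g)).
have := discoveries_shrink a_gt0 b_gt0 ab1 F_cdf w0 eta_le1.
rewrite /discoveries /nulls /alts /emp_total big_split/= -natr1 -muln2 natrM mulrDl mul1r.
by rewrite !ler_norml => A /andP[_ B] /andP[_ D]; lra.
Qed.

Lemma emp_total_ge u t : 0 < u -> feasible a C alpha u t ->
  exists2 v, weight_space c v &
    discoveries a b F t <= emp_total e0 e1 u v + (G.*2.+1)%:R * eta.
Proof.
move=> u0 [t0 tu]; have au0 : 0 < alpha * u by exact: mulr_gt0.
have /andP[e_gt0 e_lt1] := eta01.
(* These weights produce the thresholds [(1 - eta) t g]. They satisfy the empirical constraint
   because [(1 + eta) (1 - eta) <= 1]. *)
pose v : 'rV[R]_G := \row_g ((1 - eta) * t g / (alpha * u)).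
have wE g : weighted u v g = (1 - eta) * t g.
  by rewrite /weighted mxE mulrC divfK// gt_eqF.
have w0 g : 0 <= weighted u v g by rewrite wE mulr_ge0// subr_ge0 ltW.
exists v.
  split=> [g|]; first by rewrite mxE divr_ge0 ?(ltW au0)// mulr_ge0// subr_ge0 ltW.
  rewrite (eq_bigr (fun g => (c g * ((1 - eta) * t g)) / (alpha * u))); last first.
    by move=> g _; rewrite mxE mulrA.
  rewrite -mulr_suml ler_pdivrMr// mul1r (le_trans _ tu)// mulr_sumr.
  apply: ler_sum => g _.
  have /andP[_ cg] := c_close closeE g.
  apply: (@le_trans _ _ ((1 + eta) * (C * a g) * ((1 - eta) * t g))).
    by rewrite ler_wpM2r// mulr_ge0// subr_ge0 ltW.
  rewrite (_ : _ * _ * _ = (1 - eta ^+ 2) * (C * (a g * t g))); last by ring.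
  by rewrite ler_piMl ?mulr_ge0 ?(ltW C_gt0) ?(ltW (a_gt0 g))//; nra.
have := sum_close (fun g => e0_close closeE g (w0 g)).
have := sum_close (fun g => e1_close closeE g (w0 g)).
have := discoveries_shrink a_gt0 b_gt0 ab1 F_cdf t0 eta_le1.
have -> : discoveries a b F (fun g => (1 - eta) * t g) = discoveries a b F (weighted u v).
  by congr discoveries; apply/funext => g; rewrite wE.
rewrite /discoveries /nulls /alts /emp_total big_split/= -natr1 -muln2 natrM mulrDl mul1r.
by rewrite !ler_norml => A /andP[B _] /andP[D _]; lra.
Qed.

Variable w : R -> 'rV[R]_G.
Hypothesis w_space : forall u, 0 <= u <= 1 -> weight_space c (w u).
Hypothesis w_best : forall u v, 0 <= u <= 1 -> weight_space c v ->
  emp_total e0 e1 u v <= emp_total e0 e1 u (w u).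

Lemma emp_total_ge0 u v : 0 <= emp_total e0 e1 u v.
Proof.
apply: sumr_ge0 => g _.
by rewrite addr_ge0 ?(e0_ge0 closeE) ?(e1_ge0 closeE).
Qed.

(** A saturating allocation discovers at least [budget u + alts s], and the best empirical total
    nearly matches it. At most about [budget u] of that total is null, so the remainder is true. The
    errors [2G + 1] and [G + 1] add up to [3G + 2]. *)
Lemma best_alts_ge u : 0 <= u <= 1 ->
  max_alts a b F C alpha u <=
    \sum_g e1 g (weighted u (w u) g) + (3 * G + 2)%:R * eta.
Proof.
move=> u01; have /andP[u_ge0 _] := u01.
(* Recovering weights from thresholds divides by [alpha * u], so level 0 is separate. *)
have [u0|u0] := eqVneq u 0.
  rewrite u0 max_alts0// addr_ge0 ?mulr_ge0// sumr_ge0// => g _.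
  exact: (e1_ge0 closeE).
have {u0} u0 : 0 < u by rewrite lt_def u0.
apply: max_alts_le => // s fs.
have [t ft st] := feasible_saturate a_gt0 b_gt0 C_gt0 F_cdf fs.
have [v cv tv] := emp_total_ge u0 ft.
have := w_best u01 cv; have := emp_nulls_le u_ge0 (w_space u01).
move: st tv; rewrite [emp_total _ _ u (w u)]big_split /= /discoveries.
have -> : (G.*2.+1)%:R = G%:R * 2 + 1 :> R by rewrite -natr1 -muln2 natrM.
have -> : (3 * G + 2)%:R = 3 * G%:R + 2 :> R by rewrite natrD natrM.
have -> : (G.+1)%:R = G%:R + 1 :> R by rewrite natr1.
move: (\sum_g e0 _ _) (\sum_g e1 _ _) (G%:R : R) => x y n; lra.
Qed.

Let uhat := crossing (fun u => emp_total e0 e1 u (w u)).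

Lemma uhat01 : 0 <= uhat <= 1.
Proof. exact/crossing01/emp_total_ge0. Qed.

Lemma uhat_ge u t : 0 < u <= 1 -> feasible a C alpha u t ->
  u + (G.*2.+1)%:R * eta <= discoveries a b F t -> u <= uhat.
Proof.
move=> /andP[u0 u1] ft ut; have u01 : 0 <= u <= 1 by rewrite (ltW u0).
apply: crossing_ge => //; first exact: emp_total_ge0.
have [v cv tv] := emp_total_ge u0 ft.
by have := w_best u01 cv; lra.
Qed.

(** A point of the crossing set above [x] would yield a feasible allocation whose discoveries fall
    short of its level by less than [delta]. *)
Lemma uhat_le x delta : (G.*2.+1)%:R * eta < delta ->
  (forall u t, x <= u <= 1 -> feasible a C alpha u t ->
     discoveries a b F t <= u - delta) -> uhat <= x.
Proof.
move=> ed gap; apply: crossing_le => [|u u01 uh]; first exact: emp_total_ge0.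
rewrite leNgt; apply/negP => xu; have /andP[u0 u1] := u01.
have [t ft te] := emp_total_le u0 (w_space u01).
have := gap u t; rewrite (ltW xu) u1 => /(_ isT ft); lra.
Qed.

Lemma uhat_max v : (forall u, 0 <= u <= 1 -> weight_space c (v u)) ->
  crossing (fun u => emp_total e0 e1 u (v u)) <= uhat.
Proof.
move=> cv; apply: le_crossing => [|u u01]; first exact: emp_total_ge0.
by apply: w_best => //; exact: cv.
Qed.

End fixed_sample.

Let ustar := oracle_level a b F C alpha.
Let limit_power := max_alts a b F C alpha ustar.

Hypothesis supercritical_ex :
  exists2 u, 0 <= u <= 1 & supercritical a b F C alpha u.

(** The tolerance [eta0] depends on [eps] and the limit only, not on the sample or the weights;
    probability then enters only through the event of closeness. *)
Lemma power_close eps : 0 < eps -> exists2 eta0, 0 < eta0 &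
  forall e0 e1 c, close_to_limit eta0 e0 e1 c ->
  forall w : R -> 'rV[R]_G,
  (forall u, 0 <= u <= 1 -> weight_space c (w u)) ->
  (forall u v, 0 <= u <= 1 -> weight_space c v ->
     emp_total e0 e1 u v <= emp_total e0 e1 u (w u)) ->
  let power w :=
    let u := crossing (fun u => emp_total e0 e1 u (w u)) in
    \sum_g e1 g (weighted u (w u) g) in
  `|power w - limit_power| <= eps /\
  forall v : R -> 'rV[R]_G,
    (forall u, 0 <= u <= 1 -> weight_space c (v u)) ->
    power v <= limit_power + eps.
Proof.
move=> eps0.
have us0 : 0 < ustar by exact: oracle_level_gt0.
have us1 : ustar <= 1 by exact: oracle_level_le1.
(* The Lipschitz constant of [max_alts] above [ustar] is [1 / ustar], so a level error [r] costs at
   most [eps / 2]. *)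
pose r := eps / 2 * ustar.
have r0 : 0 < r by rewrite mulr_gt0// divr_gt0.
have [u u01 [[t ft ut] ur]] := oracle_level_approx supercritical_ex r0.
have [delta d0 gap] :=
  discoveries_gap a_gt0 b_gt0 ab1 C_gt0 alpha_gt0 F_cdf supercritical_ex r0.
have u0 : 0 < u.
  exact: (supercritical_gt0 a_gt0 b_gt0 ab1 C_gt0 alpha_gt0 F_cdf (ex_intro2 _ _ t ft ut)).
(* This dominates all the error constants [G + 1], [2G + 1] and [3G + 2]. *)
pose n : R := (3 * G + 2)%:R.
have n0 : 0 < n by rewrite ltr0n addnS.
(* The four bounds serve, in order, to have [eta0 < 1], to keep the error on power below [eps / 2],
   to stay within the surplus of [t] that bounds [uhat] from below, and to stay strictly within the
   gap [delta] that bounds it from above. *)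
pose eta0 := Num.min (Num.min (1 / 2) (eps / 2 / n))
               (Num.min ((discoveries a b F t - u) / n) (delta / 2 / n)).
have eta_gt0 : 0 < eta0.
  by rewrite !lt_min !divr_gt0// subr_gt0.
have eta01 : 0 < eta0 < 1.
  by rewrite eta_gt0/= !gt_min; apply/orP; left; apply/orP; left; lra.
have neps : n * eta0 <= eps / 2.
  by rewrite mulrC -ler_pdivlMr// !ge_min lexx ?orbT.
have ndel : n * eta0 <= delta / 2.
  by rewrite mulrC -ler_pdivlMr// !ge_min lexx ?orbT.
have ntot : n * eta0 <= discoveries a b F t - u.
  by rewrite mulrC -ler_pdivlMr// !ge_min lexx ?orbT.
have n2 : (G.*2.+1)%:R * eta0 <= n * eta0.
  by rewrite ler_pM2r// ler_nat -mul2n addn2 ltnS leqW// leq_mul2r orbT.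
have n1 : (G.+1)%:R * eta0 <= n * eta0.
  by rewrite ler_pM2r// ler_nat addn2 ltnS leqW// leq_pmull.
exists eta0 => // e0 e1 c ce w wc wbest power.
pose uhat := crossing (fun u => emp_total e0 e1 u (w u)).
have h01 : 0 <= uhat <= 1 := uhat01 ce w.
have /andP[h0 h1] := h01.
have hge : ustar - r <= uhat.
  apply: (le_trans (ltW ur)).
  by apply: (uhat_ge eta01 ce wbest) ft _ => //; [case/andP: u01; rewrite u0|lra].
have hle : uhat <= ustar + r.
  by apply: (uhat_le eta01 ce wc) gap; lra.
have lip u1 u2 : 0 <= u1 -> u1 <= u2 -> ustar <= u2 -> u2 - u1 <= r ->
    max_alts a b F C alpha u2 <= max_alts a b F C alpha u1 + eps / 2.
  move=> u10 u12 su2 u12r.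
  have := max_alts_lipschitz C a_gt0 b_gt0 ab1 alpha_gt0 F_cdf us0 u10 u12 su2.
  by move=> /le_trans; apply; rewrite lerD2l ler_pdivrMr.
have mono u1 u2 : 0 <= u1 -> u1 <= u2 ->
    max_alts a b F C alpha u1 <= max_alts a b F C alpha u2.
  exact: max_alts_homo.
(* Monotonicity settles one order of [uhat] and [ustar], the Lipschitz bound the other; likewise for
   [Mge]. *)
have Mle : max_alts a b F C alpha uhat <= limit_power + eps / 2.
  have [hs|/ltW sh] := leP uhat ustar; last by apply: lip; lra.
  by have := mono _ _ h0 hs; rewrite -/limit_power; lra.
have Mge : limit_power <= max_alts a b F C alpha uhat + eps / 2.
  have [hs|/ltW sh] := leP uhat ustar; first by apply: lip; lra.
  by have := mono _ _ (ltW us0) sh; rewrite -/limit_power; lra.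
split=> [|v vc].
  have := best_alts_ge eta01 ce wc wbest h01.
  have := emp_alts_le eta01 ce h0 (wc _ h01).
  rewrite -/n ler_norml -/uhat => A B.
  by apply/andP; split; rewrite /power -/uhat; lra.
(* The competitor has its own level [uv <= uhat], and its true discoveries are bounded by [max_alts]
   there, hence by [max_alts] at [uhat]. *)
pose uv := crossing (fun u => emp_total e0 e1 u (v u)).
have v01 : 0 <= uv <= 1 := uhat01 ce v.
have /andP[v0 _] := v01.
have vh : uv <= uhat := uhat_max ce wbest vc.
have := emp_alts_le eta01 ce v0 (vc _ v01).
have := mono _ _ v0 vh.
by rewrite /power -/uv; lra.
Qed.

End empirical.

(** * Convergence in probability and expectations *)

Section with_high_probability.
Context {d : measure_display} {T : measurableType d} {R : realType}.
Variable P : probability T R.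

(** Only the exceptional events [B n] are measurable: [Q n] may quantify over all thresholds or
    weight functions. *)
Definition whp (Q : nat -> T -> Prop) : Prop :=
  exists B : nat -> set T, [/\ forall n, measurable (B n),
    P (B n) @[n --> \oo] --> (0 : \bar R) &
    \forall n \near \oo, forall w, ~ B n w -> Q n w].

Lemma whp_near (Q : nat -> T -> Prop) :
  (\forall n \near \oo, forall w, Q n w) -> whp Q.
Proof.
move=> QT; exists (fun=> set0); split=> //.
  by under eq_fun do rewrite measure0; exact: cvg_cst.
by apply: filterS QT => n Qn w _; exact: Qn.
Qed.

Lemma whp_and (Q Q' : nat -> T -> Prop) : whp Q -> whp Q' ->
  whp (fun n w => Q n w /\ Q' n w).
Proof.
move=> [B [mB B0 BQ]] [B' [mB' B'0 BQ']].
exists (fun n => B n `|` B' n); split=> [n||]; first exact: measurableU.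
  apply: (@squeeze_cvge _ _ _ _ (cst 0%E) _ (fun n => P (B n) + P (B' n))%E).
  - by apply: nearW => n; rewrite measure_ge0 measureU2.
  - exact: cvg_cst.
  - by rewrite -[X in _ --> X]adde0; apply: cvgeD.
apply: filterS2 BQ BQ' => n QB QB' w /not_orP[nB nB'].
by split; [exact: QB|exact: QB'].
Qed.

Lemma whpS (Q Q' : nat -> T -> Prop) :
  (\forall n \near \oo, forall w, Q n w -> Q' n w) -> whp Q -> whp Q'.
Proof.
move=> QQ' [B [mB B0 BQ]]; exists B; split=> //.
by apply: filterS2 QQ' BQ => n Q1 Q2 w nB; apply/Q1/Q2.
Qed.

Lemma whp_forall (I : finType) (Q : I -> nat -> T -> Prop) :
  (forall i, whp (Q i)) -> whp (fun n w => forall i, Q i n w).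
Proof.
move=> wQ; suff : whp (fun n w => forall i, i \in enum I -> Q i n w).
  by apply: whpS; apply: nearW => n w + i; apply; rewrite mem_enum.
elim: (enum I) => [|i s IH]; first by apply: whp_near; apply: nearW.
apply: whpS (whp_and (wQ i) IH); apply: nearW => n w [Qi Qs] j.
by rewrite inE => /predU1P[->//|]; exact: Qs.
Qed.

Lemma whp_cvg_in_probability (X : nat -> T -> R) l eps :
  (forall n, measurable_fun setT (X n)) -> 0 < eps ->
  cvg_in_probability P X l -> whp (fun n w => `|X n w - l| < eps).
Proof.
move=> mX eps0 /(_ _ eps0) Xl; exists (fun n => [set w | eps <= `|X n w - l|]).
split=> // [n|]; last by apply: nearW => n w /= /negP; rewrite -ltNge.
have mN : measurable_fun setT (fun w => `|X n w - l|).
  by apply: measurableT_comp => //; exact: measurable_funB.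
rewrite -[X in measurable X]setTI.
rewrite (_ : [set w | _] = (fun w => `|X n w - l|) @^-1` `[eps, +oo[).
  by apply: mN => //; exact: measurable_itv.
by apply/seteqP; split => w /=; rewrite in_itv/= andbT.
Qed.

(** On [B] the indicator pays for [X <= 1], so [X <= Y + 1_B] everywhere. *)
Lemma integral_le_off (X Y : T -> R) (B : set T) : measurable B ->
  measurable_fun setT X -> measurable_fun setT Y ->
  (forall w, 0 <= X w <= 1) -> (forall w, 0 <= Y w) ->
  (forall w, ~ B w -> X w <= Y w) ->
  (\int[P]_w (X w)%:E <= \int[P]_w (Y w)%:E + P B)%E.
Proof.
move=> mB mX mY X01 Y0 XY.
have X0 w : 0 <= X w by case/andP: (X01 w).
have X1 w : X w <= 1 by case/andP: (X01 w).
have -> : P B = (\int[P]_w (\1_B w)%:E)%E by rewrite integral_indic ?setIT.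
rewrite -ge0_integralD//; first last.
- by apply/measurable_EFinP; exact: measurable_indic.
- exact/measurable_EFinP.
- by move=> w _; rewrite lee_fin.
apply: ge0_le_integral => //.
- by move=> w _; rewrite lee_fin.
- exact/measurable_EFinP.
- apply: emeasurable_funD; apply/measurable_EFinP => //.
move=> w _; rewrite -EFinD lee_fin indicE.
have [wB|wB] := boolP (w \in B); first by rewrite ler_wpDl//.
by rewrite addr0; apply: XY => /mem_set; exact/negP.
Qed.

Lemma integral_cst_probability r : (\int[P]_w r%:E = r%:E)%E.
Proof.
by rewrite -[RHS]mule1 -(@probability_setT _ _ _ P); exact: integral_cst.
Qed.

Section expectations.
Variables (X : nat -> T -> R) (l : R).
Hypothesis mX : \forall n \near \oo, measurable_fun setT (X n).
Hypothesis X01 : forall n w, 0 <= X n w <= 1.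
Hypothesis l01 : 0 <= l <= 1.

Let I n := (\int[P]_w (X n w)%:E)%E.

Lemma expectation_near_le : (forall eps, 0 < eps -> whp (fun n w => X n w <= l + eps)) ->
  forall eps, 0 < eps -> \forall n \near \oo, (I n <= (l + eps)%:E)%E.
Proof.
move=> Xl eps e0; have e2 : 0 < eps / 2 by rewrite divr_gt0.
have [B [mB B0 BQ]] := Xl _ e2; have /andP[l0 _] := l01.
have PB : \forall n \near \oo, (P (B n) < (eps / 2)%:E)%E.
  by apply: (B0 [set x | x < (eps / 2)%:E]%E); apply: open_ereal_lt'; rewrite lte_fin.
near=> n.
have : (I n <= \int[P]_w (cst (l + eps / 2) w)%:E + P (B n))%E.
  apply: integral_le_off => //; first by near: n.
    by move=> w; rewrite /= addr_ge0// ltW.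
  by near: n.
have -> : (\int[P]_w (cst (l + eps / 2) w)%:E = (l + eps / 2)%:E)%E.
  exact: integral_cst_probability.
move=> /le_trans; apply.
have -> : l + eps = l + eps / 2 + eps / 2 by lra.
by rewrite [leRHS]EFinD leeD2l// ltW//; near: n.
Unshelve. all: by end_near. Qed.

Lemma expectation_near_ge : (forall eps, 0 < eps -> whp (fun n w => l <= X n w + eps)) ->
  forall eps, 0 < eps -> \forall n \near \oo, (l%:E <= I n + eps%:E)%E.
Proof.
move=> Xl eps e0; have e2 : 0 < eps / 2 by rewrite divr_gt0.
have [B [mB B0 BQ]] := Xl _ e2; have /andP[l0 _] := l01.
have PB : \forall n \near \oo, (P (B n) < (eps / 2)%:E)%E.
  by apply: (B0 [set x | x < (eps / 2)%:E]%E); apply: open_ereal_lt'; rewrite lte_fin.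
have X0 n w : 0 <= X n w by case/andP: (X01 n w).
near=> n.
have mXn : measurable_fun setT (X n) by near: n.
have : (\int[P]_w (cst l w)%:E <= \int[P]_w (X n w + eps / 2)%:E + P (B n))%E.
  apply: integral_le_off => //; last by near: n.
    by apply: measurable_funD.
  by move=> w; rewrite addr_ge0// ltW.
rewrite integral_cst_probability.
have -> : (\int[P]_w (X n w + eps / 2)%:E = I n + (eps / 2)%:E)%E.
  under eq_integral do rewrite EFinD.
  rewrite ge0_integralD//.
  - by rewrite integral_cst_probability.
  - by move=> w _; rewrite lee_fin.
  - exact/measurable_EFinP.
  - by move=> w _; rewrite lee_fin ltW.
move=> /le_trans; apply.
rewrite [in leRHS](splitr eps) EFinD addeA.
by rewrite leeD2l// ltW//; near: n.
Unshelve. all: by end_near. Qed.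

Lemma limn_esup_expectation_le :
  (forall eps, 0 < eps -> whp (fun n w => X n w <= l + eps)) ->
  (limn_esup I <= l%:E)%E.
Proof.
move=> Xl; apply/lee_addgt0Pr => eps e0.
(* [limn_esup] is an infimum of suprema over neighbourhoods of infinity; the set where the bound
   holds is one of them. *)
apply: (@le_trans _ _ (ereal_sup [set I n | n in [set n | (I n <= (l + eps)%:E)%E]])).
  apply: ereal_inf_lbound.
  by exists [set n | (I n <= (l + eps)%:E)%E] => //; exact: expectation_near_le.
by apply: ge_ereal_sup => _ [n /= In <-].
Qed.

Lemma cvg_expectation :
  (forall eps, 0 < eps -> whp (fun n w => `|X n w - l| <= eps)) ->
  I n @[n --> \oo] --> l%:E.
Proof.
move=> Xl.
have lo : forall eps, 0 < eps -> \forall n \near \oo, (l%:E <= I n + eps%:E)%E.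
  apply: expectation_near_ge => eps e0; apply: whpS (Xl _ e0).
  by apply: nearW => n w; rewrite ler_norml => /andP[]; lra.
have hi : forall eps, 0 < eps -> \forall n \near \oo, (I n <= (l + eps)%:E)%E.
  apply: expectation_near_le => eps e0; apply: whpS (Xl _ e0).
  by apply: nearW => n w; rewrite ler_norml => /andP[]; lra.
have I0 n : (0 <= I n)%E.
  by apply: integral_ge0 => w _; rewrite lee_fin; case/andP: (X01 n w).
have Ifin : \forall n \near \oo, I n \is a fin_num.
  apply: filterS (hi 1 ltr01) => n In.
  by rewrite ge0_fin_numE// (le_lt_trans In)// ltry.
apply/fine_cvgP; split => //.
apply/cvgrPdist_le => eps e0; near=> n.
have fI : I n \is a fin_num by near: n.
have : (l%:E <= I n + eps%:E)%E by near: n; exact: lo.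
have : (I n <= (l + eps)%:E)%E by near: n; exact: hi.
rewrite /= -(fineK fI) -EFinD !lee_fin /= => A B.
by rewrite ler_norml; apply/andP; split; lra.
Unshelve. all: by end_near. Qed.

End expectations.
End with_high_probability.

(** * The critical level *)

Section supercriticality.
Context {R : realType} {G : nat}.

(** By concavity and [F 0 = 0], [F x / x] is nonincreasing, so its right limit at 0 exists in the
    extended reals. *)
Lemma slope0_cvg (F : R -> R) : concave_cdf F ->
  (F x / x)%:E @[x --> 0^'+] --> slope0 F.
Proof.
move=> cF; rewrite /slope0 (cdf_at0 cF).
under [in X in _ --> X]eq_fun do rewrite subr0.
have h : {in `]0, 1[ &, {homo (fun x => (F x / x)%:E) : n m / n <= m >-> (m <= n)%E}}.
  move=> x y; rewrite !in_itv/= => /andP[x0 _] /andP[y0 _] xy.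
  rewrite lee_fin ler_pdivlMr//.
  have x01 : 0 <= x / y <= 1 by rewrite divr_ge0 ?(ltW x0) ?(ltW y0)//= ler_pdivrMr// mul1r.
  have := concave_cdf_scale cF (ltW y0) x01.
  rewrite divfK ?gt_eqF//; apply: le_trans.
  by rewrite (_ : F y / y * x = x / y * F y)//; ring.
have b01 : (BRight 0 < BLeft (1 : R))%O by rewrite bnd_simp.
have := nonincreasing_at_right_cvge _ b01 h.
by move=> c; rewrite (cvg_lim (@ereal_hausdorff R) c).
Qed.

Lemma slope0_ge0 (F : R -> R) : concave_cdf F -> (0 <= slope0 F)%E.
Proof.
move=> cF; apply: (cvge_to_ge (slope0_cvg cF)); near=> x.
have x0 : 0 < x by near: x; exact: nbhs_right_gt.
by rewrite lee_fin divr_ge0 ?(concave_cdf_ge0 cF) ?(ltW x0).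
Unshelve. all: by end_near. Qed.

Lemma unif_slope_cvg : (unif_cdf x / x : R)%:E @[x --> 0^'+] --> (1%:E : \bar R).
Proof.
apply: cvg_near_cst; near=> x.
have x0 : 0 < x by near: x; exact: nbhs_right_gt.
have x1 : x <= 1 by near: x; exact: nbhs_right_le.
rewrite unif_cdfE ?ltW//.
have -> : Num.min x 1 = x by apply/min_idPl.
by rewrite divff// gt_eqF.
Unshelve. all: by end_near. Qed.

Lemma cvg_mul_right0 (k : R) : 0 < k -> k * x @[x --> 0^'+] --> 0^'+.
Proof.
move=> k0 A; rewrite /= !nbhs_simpl => -[e /= e0 eA].
exists (e / k); rewrite /= ?divr_gt0// => x /= xe x0.
apply: eA; last exact: mulr_gt0.
move: xe; rewrite /= !sub0r !normrN normrM (gtr0_norm k0) => xe.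
by rewrite mulrC -ltr_pdivlMr.
Qed.

Lemma mixture_slope_cvg (F : R -> R) (a b k : R) : concave_cdf F ->
  0 <= a -> 0 <= b -> 0 < k ->
  ((a * unif_cdf (k * u) + b * F (k * u)) / u)%:E @[u --> 0^'+] -->
    (k%:E * (a%:E + b%:E * slope0 F))%E.
Proof.
move=> cF a0 b0 k0.
have c : ((a * unif_cdf x + b * F x) / x)%:E @[x --> 0^'+] -->
    (a%:E * 1%:E + b%:E * slope0 F)%E.
  rewrite (_ : (fun x => _) = (fun x =>
      a%:E * (unif_cdf x / x)%:E + b%:E * (F x / x)%:E)%E); last first.
    by apply/funext => x; rewrite -!EFinM -EFinD mulrDl -!(mulrA _ _ x^-1).
  apply: cvgeD.
  - by rewrite -EFinM ge0_adde_def// inE ?lee_fin ?mulr1// mule_ge0 ?slope0_ge0.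
  - by apply: cvgeZl => //; exact: unif_slope_cvg.
  - by apply: cvgeZl => //; exact: slope0_cvg.
have ck := cvg_comp _ _ (cvg_mul_right0 k0) c.
rewrite mule1 in ck; have := cvgeZl (y := k%:E) isT ck.
apply: cvg_trans; apply: near_eq_cvg; near=> u.
have u0 : 0 < u by near: u; exact: nbhs_right_gt.
rewrite /= -EFinM; congr EFin; rewrite invfM; field.
by rewrite !gt_eqF.
Unshelve. all: by end_near. Qed.

(** Some oracle weight [w] satisfies [1 < alpha S], with [S] the denominator in [alpha_star]. With
    [w] held constant, discoveries divided by [u] tend to [alpha S] as [u] decreases to 0, so they
    exceed [u] for some small [u]. *)
Lemma supercritical_of_alpha_star (piG pi0 pibar : 'I_G -> R)
    (F : 'I_G -> R -> R) (C alpha : R) :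
  (forall g, 0 < piG g) -> (forall g, 0 < pi0 g < 1) ->
  (forall g, concave_cdf (F g)) -> (forall g, pibar g = C * pi0 g) ->
  (alpha_star piG pi0 pibar F < alpha%:E)%E ->
  0 < alpha /\ exists2 u, 0 <= u <= 1 &
    supercritical (fun g => piG g * pi0 g) (fun g => piG g * (1 - pi0 g)) F C
      alpha u.
Proof.
move=> piG_gt0 pi0_01 cF pibarE /ereal_inf_lt[_ [w [w0 w1] <-]].
have pi00 g : 0 < pi0 g by case/andP: (pi0_01 g).
have pi10 g : 0 < 1 - pi0 g by case/andP: (pi0_01 g) => _; rewrite subr_gt0.
have term0 g : (0 <= (piG g * w 0 g)%:E *
    ((pi0 g)%:E + (1 - pi0 g)%:E * slope0 (F g)))%E.
  rewrite mule_ge0 ?lee_fin ?mulr_ge0 ?(ltW (piG_gt0 g))//.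
  rewrite adde_ge0 ?lee_fin ?(ltW (pi00 g))//.
  by rewrite mule_ge0 ?lee_fin ?(ltW (pi10 g))// slope0_ge0.
set S := (\sum_(g < G) _)%E => Sa.
have S0 : (0 <= S)%E by apply: sume_ge0 => g _; exact: term0.
(* The value [S = 0] is excluded since its inverse is [+oo]; for [S = +oo] the hypothesis reads
   [0 < alpha] and the product is infinite. *)
have [alpha0 aS1] : 0 < alpha /\ (1 < alpha%:E * S)%E.
  move: S0 Sa; case: S => [s| |]//.
  - rewrite lee_fin le_eqVlt => /predU1P[<-|s0]; first by rewrite inve0.
    rewrite inver gt_eqF//.
    rewrite lte_fin => sa; have a0 : 0 < alpha by rewrite (lt_trans _ sa)// invr_gt0.
    by split=> //; rewrite -EFinM lte_fin -ltr_pdivrMr// mul1r.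
  - by rewrite invey lte_fin => _ a0; split=> //; rewrite gt0_muley ?lte_fin// ltry.
split=> //.
pose D g x := piG g * pi0 g * unif_cdf x + piG g * (1 - pi0 g) * F g x.
have D0 g x : 0 <= x -> 0 <= D g x.
  move=> x0; apply: addr_ge0; apply: mulr_ge0.
  - by rewrite ltW// mulr_gt0.
  - exact: (concave_cdf_ge0 unif_cdf_concave).
  - by rewrite ltW// mulr_gt0.
  - exact: (concave_cdf_ge0 (cF g)).
have c g : (D g (alpha * u * w 0 g) / u)%:E @[u --> 0^'+] -->
    (alpha%:E * ((piG g * w 0 g)%:E *
       ((pi0 g)%:E + (1 - pi0 g)%:E * slope0 (F g))))%E.
  (* Rescaling needs a positive weight. At weight 0 the limit is 0 even for an infinite slope, in
     accordance with [0 * +oo = 0]. *)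
  have [wg|wg] := eqVneq (w 0 g) 0.
    rewrite wg mulr0 mul0e mule0; apply: cvg_near_cst; near=> u.
    by rewrite mulr0 /D (cdf_at0 (cF g)) (cdf_at0 unif_cdf_concave) !mulr0 addr0 mul0r.
  have k0 : 0 < alpha * w 0 g by rewrite mulr_gt0// lt_def wg w0.
  have := mixture_slope_cvg (a := piG g * pi0 g) (b := piG g * (1 - pi0 g)) (cF g) _ _ k0.
  rewrite !ltW ?mulr_gt0// => /(_ isT isT).
  rewrite (_ : (alpha * w 0 g)%:E * _ = alpha%:E * ((piG g * w 0 g)%:E *
       ((pi0 g)%:E + (1 - pi0 g)%:E * slope0 (F g))))%E; last first.
    have : (0 <= (1 - pi0 g)%:E * slope0 (F g))%E.
      by rewrite mule_ge0 ?lee_fin ?(ltW (pi10 g))// slope0_ge0.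
    rewrite [X in (_ + X)%E](_ : _ =
      (piG g)%:E * ((1 - pi0 g)%:E * slope0 (F g)))%E; last first.
      by rewrite muleA -EFinM.
    move=> q0; rewrite (EFinM (piG g) (pi0 g)) -ge0_muleDr ?lee_fin ?(ltW (pi00 g))//.
    by rewrite !EFinM -!muleA; congr (_ * _)%E; rewrite muleCA.
  rewrite (_ : (fun u => (D g (alpha * u * w 0 g) / u)%:E) =
               (fun u => (D g (alpha * w 0 g * u) / u)%:E))//.
  by apply/funext => u; rewrite (mulrAC alpha u).
have cS : (\sum_g (D g (alpha * u * w 0 g) / u)%:E)%E @[u --> 0^'+] -->
    (alpha%:E * S)%E.
  rewrite ge0_sume_distrr; last by move=> g _; exact: term0.
  apply: cvg_nnesum => g _; last exact: c.
  near=> u; have u0 : 0 < u by near: u; exact: nbhs_right_gt.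
  by rewrite lee_fin divr_ge0 ?D0 ?mulr_ge0 ?(ltW alpha0) ?(ltW u0).
have nS := cS [set x | 1 < x]%E (open_ereal_gt' aS1).
have [u [u0 u1 Su]] : exists u, [/\ 0 < u, u <= 1 &
    (1 < \sum_g (D g (alpha * u * w 0 g) / u)%:E)%E].
  near (0 : R)^'+ => u; exists u; split.
  - by near: u; exact: nbhs_right_gt.
  - by near: u; exact: nbhs_right_le.
  - by near: u.
exists u; first by rewrite u1 ltW.
exists (fun g => alpha * u * w 0 g).
  split=> [g|]; first by rewrite !mulr_ge0// ltW.
  apply: (@le_trans _ _ (alpha * u * \sum_(g < G) piG g * pibar g * w 0 g)).
    rewrite le_eqVlt; apply/orP; left; apply/eqP; rewrite !mulr_sumr.
    by apply: eq_bigr => g _; rewrite pibarE; ring.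
  by rewrite ler_piMr// mulr_ge0// ltW.
move: Su; rewrite sumEFin lte_fin -mulr_suml ltr_pdivlMr// mul1r.
by rewrite discoveries_sum.
Unshelve. all: by end_near. Qed.

End supercriticality.

(** * Empirical distribution functions *)

Section empirical_cdf.
Context {R : realType}.

(** Division is by the total number [m] of hypotheses, not the group size: the sum over groups is
    then [Ghat], and the limits carry the masses [a_g] and [b_g]. *)
Definition emp_cdf (m n : nat) (x : 'I_n -> R) (s : 'I_n -> bool) (t : R) : R :=
  m%:R^-1 * \sum_(i < n) ((x i <= t) && s i)%:R.

Lemma emp_cdf_ge0 m n (x : 'I_n -> R) s t : 0 <= emp_cdf m x s t.
Proof. by rewrite mulr_ge0 ?invr_ge0 ?sumr_ge0. Qed.

Lemma emp_cdf_homo m n (x : 'I_n -> R) s t t' : t <= t' ->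
  emp_cdf m x s t <= emp_cdf m x s t'.
Proof.
move=> tt'; rewrite ler_wpM2l ?invr_ge0//; apply: ler_sum => i _.
rewrite ler_nat; case: (s i); rewrite ?andbF ?andbT//.
by case: (leP (x i) t) => // /le_trans ->.
Qed.

Lemma emp_cdf_ge1 m n (x : 'I_n -> R) s t : (forall i, x i <= 1) -> 1 <= t ->
  emp_cdf m x s t = emp_cdf m x s 1.
Proof.
move=> x1 t1; congr (_ * _); apply: eq_bigr => i _.
by rewrite x1 (le_trans (x1 i)).
Qed.

Lemma n_null_sum n (H : 'I_n -> bool) : n_null H = (\sum_(i < n) ~~ H i)%N.
Proof.
suff e : n = (\sum_(i < n) ~~ H i + n_alt H)%N by rewrite /n_null [X in (X - _)%N]e addnK.
rewrite -big_split /= -[LHS]card_ord -sum1_card; apply: eq_bigr => i _.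
by case: (H i).
Qed.

Lemma n_null_alt n (H : 'I_n -> bool) : (n_null H + n_alt H = n)%N.
Proof.
rewrite n_null_sum -big_split /= -[RHS]card_ord -sum1_card; apply: eq_bigr => i _.
by case: (H i).
Qed.

Section realization.
Context {G : nat}.
Variables (m : nat) (ms : 'I_G -> nat) (alpha : R).
Variables (p : forall g, 'I_(ms g) -> R) (H : forall g, 'I_(ms g) -> bool).
Arguments p : clear implicits.
Arguments H : clear implicits.

Definition emp_null (g : 'I_G) := emp_cdf m (p g) (fun i => ~~ H g i).
Definition emp_alt (g : 'I_G) := emp_cdf m (p g) (H g).

Lemma Ghat_emp (W : R -> 'rV[R]_G) u :
  Ghat m alpha p W u = emp_total alpha emp_null emp_alt u (W u).
Proof.
rewrite /Ghat mulr_sumr; apply: eq_bigr => g _.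
rewrite -mulrDr -big_split; congr (_ * _); apply: eq_bigr => i _ /=.
by rewrite -natrD; case: (H g i); rewrite ?andbT ?andbF ?addn0 ?add0n.
Qed.

Lemma true_rejections_emp (W : R -> 'rV[R]_G) :
  m%:R^-1 * #|MWBH m alpha p W :&: alternatives H|%:R =
  let u := crossing (fun u => emp_total alpha emp_null emp_alt u (W u)) in
  \sum_g emp_alt g (weighted alpha u (W u) g).
Proof.
cbv zeta; set u := crossing _; have uE : uhat m alpha p W = u.
  by congr crossing; apply/funext => v; exact: Ghat_emp.
rewrite -mulr_sumr; congr (_ * _).
under eq_bigr do under eq_bigr do rewrite -[_ && _]andTb.
rewrite (sig_big_dep (fun=> true) (fun _ _ => true) (fun g i =>
   ((p g i <= weighted alpha u (W u) g) && H g i)%:R : R)) /=.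
rewrite -natr_sum -sum1_card big_mkcond /=; congr (_%:R); apply: eq_bigr => h _.
by rewrite !inE uE; case: (_ && _).
Qed.

Lemma true_rejections01 (D : {set hyp ms}) : (\sum_g ms g = m)%N ->
  0 <= (m%:R^-1 * #|D :&: alternatives H|%:R : R) <= 1.
Proof.
move=> msm; rewrite mulr_ge0 ?invr_ge0//=.
have cD : (#|D :&: alternatives H| <= m)%N.
  rewrite (leq_trans (max_card _))// card_tagged -msm sumnE big_map big_enum /=.
  by under eq_bigr do rewrite card_ord.
(* At [m = 0] the convention [0^-1 = 0] gives the bound. *)
have [->|m0] := posnP m; first by rewrite invr0 mul0r.
by rewrite mulrC ler_pdivrMr ?ltr0n// mul1r ler_nat.
Qed.

End realization.
End empirical_cdf.

(** * Uniform convergence of the empirical distribution functions *)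

Section weak_dependence.
Context {d : measure_display} {T : measurableType d} {R : realType}.
Variable P : probability T R.

Lemma measurable_emp_count (n : nat) (x : 'I_n -> {RV P >-> R}) (s : 'I_n -> bool)
    (c t : R) :
  measurable_fun setT (fun w => c * \sum_(i < n) ((x i w <= t) && s i)%:R).
Proof.
apply: measurable_funM => //; apply: measurable_sum => i.
rewrite (_ : (fun w => _) =
    (fun w => \1_(x i @^-1` `]-oo, t]) w * (s i)%:R : R)); last first.
  apply/funext => w; rewrite indicE -natrM mulnb; congr (_ && _)%:R.
  by apply/idP/idP; rewrite !inE/= in_itv.
apply: measurable_funM => //; apply: measurable_indic.
rewrite -[X in measurable X]setTI; exact: measurable_funP.
Qed.

(** Weak dependence is used at finitely many grid points, and [grid_approx] then makes it uniform in
    [t]. The change of normalization from [k m] to [m] brings in the factor [a]. *)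
Lemma whp_emp_cdf (n k : nat -> nat) (x : forall m, 'I_(n m) -> {RV P >-> R})
    (s : forall m, 'I_(n m) -> bool) (f : R -> R) (a : R) :
  concave_cdf f -> 0 < a -> (forall m i w, x m i w <= 1) ->
  (forall m, k m <= m)%N ->
  (k m)%:R / m%:R @[m --> \oo] --> a ->
  (forall t, 0 <= t -> cvg_in_probability P (fun m w => (k m)%:R^-1 *
     \sum_(i < n m) ((x m i w <= t) && s m i)%:R) (f t)) ->
  forall eta, 0 < eta -> whp P (fun m w => forall t, 0 <= t ->
    `|emp_cdf m (fun i => x m i w) (s m) t - a * f t| <= eta).
Proof.
move=> cf a0 x1 km ka wd eta eta0.
have eta2 : 0 < eta / 2 by rewrite divr_gt0.
have eta4 : 0 < eta / 4 by rewrite divr_gt0.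
(* Continuity at 0 gives a mesh [1 / K] on which increments cost at most [eta / 2]. *)
have [K K0 fK] : exists2 K : nat, (0 < K)%N & a * f K%:R^-1 <= eta / 2.
  have c : a * f y @[y --> 0^'+] --> a * 0 by apply: cvgMr; exact: (cdf_cvg0 cf).
  have : \forall y \near (0 : R)^'+, a * f y <= eta / 2.
    by apply: (cvgr_le _ c); rewrite mulr0.
  move=> [e /= e0 eP].
  pose K := (Num.truncn e^-1).+1.
  have Ke : e^-1 < K%:R by exact: truncnS_gt.
  have KR : (0 : R) < K%:R by rewrite ltr0n.
  exists K => //; apply: eP => /=; last by rewrite invr_gt0.
  by rewrite sub0r normrN gtr0_norm ?invr_gt0// -[ltRHS]invrK ltf_pV2 ?posrE ?invr_gt0.
have grid : whp P (fun m w => forall j : 'I_K.+1,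
    `|(k m)%:R^-1 * (\sum_(i < n m) ((x m i w <= j%:R / K%:R) && s m i)%:R)
      - f (j%:R / K%:R)| < eta / 4).
  apply: whp_forall => j; apply: whp_cvg_in_probability => //.
    by move=> m; exact: measurable_emp_count.
  by apply: wd; rewrite divr_ge0.
have ka4 : \forall m \near \oo, `|a - (k m)%:R / m%:R| <= eta / 4.
  by move/cvgrPdist_le : ka; exact.
have k0 : \forall m \near \oo, 0 < (k m)%:R / m%:R :> R.
  by apply: (cvgr_gt a) ka _ a0.
apply: whpS grid; near=> m => w gridw t t0.
have k0m : 0 < (k m)%:R / m%:R :> R by near: m.
have ka4m : `|a - (k m)%:R / m%:R| <= eta / 4 by near: m.
have kn0 : (k m)%:R != 0 :> R by apply: contraTneq k0m => ->; rewrite mul0r ltxx.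
have m0 : 0 < m%:R :> R.
  by rewrite ltr0n lt0n; apply: contraTneq k0m => ->; rewrite invr0 mulr0 ltxx.
rewrite (splitr eta); apply: (grid_approx cf K0) => //.
- exact: ltW.
- by move=> y y' _; exact: emp_cdf_homo.
- by move=> y; apply: emp_cdf_ge1 => i.
move=> j; have := gridw j; set S := \sum_(i < n m) _; set y := _ / _.
have y0 : 0 <= y by rewrite divr_ge0.
have f0 := concave_cdf_ge0 cf y0; have f1 := concave_cdf_le1 cf y0.
have -> : emp_cdf m (fun i => x m i w) (s m) y = (k m)%:R / m%:R * ((k m)%:R^-1 * S).
  rewrite [LHS](_ : _ = m%:R^-1 * S)//; field.
  by rewrite kn0 gt_eqF.
have : (k m)%:R / m%:R <= 1 :> R by rewrite ler_pdivrMr// mul1r ler_nat.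
move: k0m ka4m; set q := _ / _; set X := _ * S => q0 qa q1 Xf.
(* Since [q <= 1] and [f y <= 1], each term contributes at most [eta / 4]. *)
have -> : q * X - a * f y = q * (X - f y) - (a - q) * f y by ring.
clearbody q X; apply: (le_trans (ler_normB _ _)).
rewrite !normrM (gtr0_norm q0) (ger0_norm f0).
have := normr_ge0 (X - f y); have := normr_ge0 (a - q).
by move: (`|X - f y|) (`|a - q|) Xf qa => A B; nra.
Unshelve. all: by end_near. Qed.

(** Values in [[0, 1]] make the distribution function 1 from 1 on; right continuity and [F 0 = 0]
    give the limit at 0. *)
Lemma concave_cdf_of_RV (X : {RV P >-> R}) (F : R -> R) :
  (forall w, 0 <= X w <= 1) -> (forall x, cdf X x = (F x)%:E) ->
  strictly_concave_on `[0, 1] F -> F 0 = 0 -> concave_cdf F.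
Proof.
move=> X01 XF Fc F0; apply: strictly_concave_on_concave_cdf => //.
- move=> x x1; apply/EFin_inj; rewrite -XF /cdf /distribution /pushforward.
  rewrite (_ : _ @^-1` _ = setT) ?probability_setT//.
  apply/seteqP; split => // w _ /=; rewrite in_itv /=.
  by case/andP: (X01 w) => _ /le_trans; exact.
- by move=> x y xy; rewrite -lee_fin -!XF; exact: cdf_nondecreasing.
- have : cdf X r @[r --> 0^'+] --> cdf X 0 by exact: cdf_right_continuous.
  rewrite XF F0 (_ : cdf X = fun r => (F r)%:E); first by move/fine_cvgP => [].
  exact/funext.
Qed.

End weak_dependence.

Section pow.
Context {d : measure_display} {T : measurableType d} {R : realType}.
Variable P : probability T R.

(** At [m = 0] both sides vanish because [0^-1 = 0], whence the guard on measurability. *)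
Lemma PowE (G m : nat) (ms : 'I_G -> nat) (H : forall g, 'I_(ms g) -> bool)
    (D : T -> {set hyp ms}) :
  ((0 < m)%N -> measurable_fun setT (true_rejections R H D)) ->
  Pow P m H D = (\int[P]_w (m%:R^-1 * true_rejections R H D w)%:E)%E.
Proof.
have [->|m0 /(_ isT) mD] := posnP m.
  move=> _; rewrite /Pow invr0 mul0e.
  by under eq_integral do rewrite mul0r; rewrite integral0.
rewrite /Pow unlock -ge0_integralZl_EFin//.
- by move=> w _; rewrite lee_fin.
- exact/measurable_EFinP.
Qed.

End pow.

(** * Comparison of the asymptotic powers *)

Theorem theorem5p2 (R : realType) (d : measure_display) (T : measurableType d)
  (P : probability T R) (G : nat) (G_ge2 : (1 < G)%N)
  (* group sizes *)
  (ms : nat -> 'I_G -> nat)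
  (ms_mono : forall g m n, (m <= n)%N -> (ms m g <= ms n g)%N)
  (ms_sum : forall m, (\sum_(g < G) ms m g)%N = m)
  (* hypotheses (H = true: the null is false) and p-values *)
  (H : forall m g, 'I_(ms m g) -> bool)
  (p : forall m g, 'I_(ms m g) -> {RV P >-> R})
  (p01 : forall m g i w, 0 <= p m g i w <= 1)
  (* null p-values are uniform *)
  (p_null : forall m g i, ~~ H m g i -> forall A : set R, measurable A ->
     distribution P (p m g i) A = uniform_prob (@ltr01 R) A)
  (* p-values under the alternative *)
  (F : 'I_G -> R -> R)
  (p_alt : forall m g i, H m g i -> forall x, cdf (p m g i) x = (F g x)%:E)
  (F_concave : forall g, strictly_concave_on `[0, 1] (F g))
  (F0 : forall g, F g 0 = 0)
  (* asymptotic proportions *)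
  (piG pi0 : 'I_G -> R)
  (piG_gt0 : forall g, 0 < piG g)
  (pi0_gt0 : forall g, 0 < pi0 g)
  (pi1_gt0 : forall g, 0 < 1 - pi0 g)
  (ms_cvg : forall g, (ms m g)%:R / m%:R @[m --> \oo] --> piG g)
  (m0_cvg : forall g,
     (n_null (H m g))%:R / (ms m g)%:R @[m --> \oo] --> pi0 g)
  (* weak dependence *)
  (weak_dep_null : forall g (t : R), 0 <= t ->
     cvg_in_probability P (fun m w => (n_null (H m g))%:R^-1 *
       \sum_(i < ms m g) ((p m g i w <= t)%R && ~~ H m g i)%:R) (unif_cdf t))
  (weak_dep_alt : forall g (t : R), 0 <= t ->
     cvg_in_probability P (fun m w => (n_alt (H m g))%:R^-1 *
       \sum_(i < ms m g) ((p m g i w <= t)%R && H m g i)%:R) (F g t))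
  (* estimators of pi0 *)
  (pihat : nat -> 'I_G -> {RV P >-> R}) (pibar : 'I_G -> R)
  (pihat01 : forall m g w, (0 < m)%N -> 0 < pihat m g w <= 1)
  (pihat_cvg : forall g, cvg_in_probability P (fun m => pihat m g) (pibar g))
  (pibar_ge : forall g, pi0 g <= pibar g)
  (* target level *)
  (alpha : R)
  (alpha_gt : (alpha_star piG pi0 pibar F < alpha%:E)%E)
  (alpha_lt1 : alpha < 1)
  (* the additional assumption *)
  (C : R) (C_ge1 : 1 <= C) (pibarE : forall g, pibar g = C * pi0 g) :
  let pval (m : nat) (w : T) := fun g (i : 'I_(ms m g)) => p m g i w in
  let Khat (m : nat) (w : T) : set 'rV[R]_G :=
    weight_space (fun g => (ms m g)%:R / m%:R * pihat m g w) in
  let MWBH_of (W : nat -> T -> R -> 'rV[R]_G) (m : nat) (w : T) :=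
    MWBH m alpha (pval m w) (W m w) in
  forall
  (* the weight functions of ADDOW *)
  (Wstar : nat -> T -> R -> 'rV[R]_G)
  (Wstar_K : forall m w u, (0 < m)%N -> 0 <= u <= 1 ->
     Khat m w (Wstar m w u))
  (Wstar_max : forall m w u, (0 < m)%N -> 0 <= u <= 1 ->
     is_maximum [set Ghat m alpha (pval m w) (fun=> v) u | v in Khat m w]
       (Ghat m alpha (pval m w) (Wstar m w) u))
  (Wstar_meas : forall m, (0 < m)%N ->
     measurable_fun setT (true_rejections R (H m) (MWBH_of Wstar m)))
  (* the competing weight functions *)
  (What : nat -> T -> R -> 'rV[R]_G)
  (What_K : forall m w u, (0 < m)%N -> 0 <= u <= 1 ->
     Khat m w (What m w u))
  (What_mono : forall m w u v, (0 < m)%N -> 0 <= u -> u <= v -> v <= 1 ->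
     Ghat m alpha (pval m w) (What m w) u <=
     Ghat m alpha (pval m w) (What m w) v)
  (What_meas : forall m, (0 < m)%N ->
     measurable_fun setT (true_rejections R (H m) (MWBH_of What m))),
  exists l : R,
    Pow P m (H m) (MWBH_of Wstar m) @[m --> \oo] --> l%:E /\
    (limn_esup (fun m => Pow P m (H m) (MWBH_of What m)) <= l%:E)%E.
Proof.
move=> pval Khat MWBH_of Wstar Wstar_K Wstar_max Wstar_meas What What_K What_mono What_meas.
have pi0_01 g : 0 < pi0 g < 1 by rewrite pi0_gt0 -subr_gt0 pi1_gt0.
have C_gt0 : 0 < C by exact: lt_le_trans ltr01 C_ge1.
have ms_le m g : (ms m g <= m)%N.
  by rewrite -[leqRHS](ms_sum m) (bigD1 g)//= leq_addr.
pose a g := piG g * pi0 g.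
pose b g := piG g * (1 - pi0 g).
have a_gt0 g : 0 < a g by rewrite mulr_gt0.
have b_gt0 g : 0 < b g by rewrite mulr_gt0.
have null_cvg g : (n_null (H m g))%:R / m%:R @[m --> \oo] --> a g.
  have -> : (fun m => (n_null (H m g))%:R / m%:R : R) =
      (fun m => (ms m g)%:R / m%:R * ((n_null (H m g))%:R / (ms m g)%:R)).
    (* In an empty group every quotient takes the default value 0, so the factorization still
       holds. *)
    apply/funext => m; have [m0|m0] := eqVneq ((ms m g)%:R : R) 0.
      have -> : n_null (H m g) = 0%N.
        apply/eqP; rewrite -leqn0 (leq_trans (leq_subr _ _))// leqn0.
        by rewrite -(pnatr_eq0 R) m0.
      by rewrite !mul0r mulr0.
    by rewrite mulrAC mulrCA mulrA mulfK// mulrC.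
  exact: cvgM.
have alt_cvg g : (n_alt (H m g))%:R / m%:R @[m --> \oo] --> b g.
  have -> : (fun m => (n_alt (H m g))%:R / m%:R : R) =
      (fun m => (ms m g)%:R / m%:R - (n_null (H m g))%:R / m%:R).
    apply/funext => m; rewrite -mulrBl -[in X in X - _](n_null_alt (H m g)).
    by rewrite natrD addrAC subrr add0r.
  by rewrite /b mulrBr mulr1; exact: cvgB.
(* Since [b g > 0], group [g] has an alternative for some [m]; its p-value has distribution function
   [F g], which thereby inherits the properties of a c.d.f. *)
have F_cdf g : concave_cdf (F g).
  have alt_gt0 : \forall m \near \oo, (0 < n_alt (H m g))%N.
    have : \forall m \near \oo, 0 < (n_alt (H m g))%:R / m%:R :> R.
      by apply: (cvgr_gt _ (alt_cvg g)).
    apply: filterS => m; rewrite lt0n; apply: contraTneq => ->.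
    by rewrite mul0r ltxx.
  have [m m0] : exists m, (0 < n_alt (H m g))%N.
    by have [N _ /(_ N (leqnn N))] := alt_gt0; exists N.
  have [i Hi] : exists i, H m g i.
    apply/existsP; apply: contraTT m0; rewrite negb_exists => /forallP Hn.
    by rewrite -leqNgt leqn0 /n_alt big1// => i _; rewrite (negbTE (Hn i)).
  exact: (concave_cdf_of_RV (p01 m g i) (p_alt m g i Hi) (F_concave g) (F0 g)).
have ab1 : \sum_g (a g + b g) = 1.
  have s1 : \sum_g (ms m g)%:R / m%:R @[m --> \oo] --> \sum_g piG g.
    by apply: cvg_big => [|g _]; [exact: add_continuous|exact: ms_cvg].
  have -> : \sum_g (a g + b g) = \sum_g piG g.
    by apply: eq_bigr => g _; rewrite /a /b; ring.
  apply: (cvg_unique (@Rhausdorff R) s1); apply: cvg_near_cst; near=> m.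
  have m0 : (0 < m)%N by near: m; exact: nbhs_infty_gt.
  by rewrite -mulr_suml -natr_sum ms_sum divff// pnatr_eq0 -lt0n.
have [alpha_gt0 sc] := supercritical_of_alpha_star piG_gt0 pi0_01 F_cdf pibarE alpha_gt.
set l := max_alts a b F C alpha (oracle_level a b F C alpha).
pose e0 m w := emp_null m (pval m w) (H m).
pose e1 m w := emp_alt m (pval m w) (H m).
pose c m w g := (ms m g)%:R / m%:R * pihat m g w.
have close eta : 0 < eta ->
    whp P (fun m w => close_to_limit a b F C eta (e0 m w) (e1 m w) (c m w)).
  move=> eta0.
  have w0 : whp P (fun m w => forall g, forall t, 0 <= t ->
      `|e0 m w g t - a g * unif_cdf t| <= eta).
    apply: whp_forall => g.
    apply: (whp_emp_cdf (x := fun m => p m g) (s := fun m i => ~~ H m g i)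
      unif_cdf_concave (a_gt0 g) _ _ (null_cvg g) (weak_dep_null g) eta0).
    - by move=> m i w; case/andP: (p01 m g i w).
    - by move=> m; rewrite (leq_trans (leq_subr _ _)).
  have w1 : whp P (fun m w => forall g, forall t, 0 <= t ->
      `|e1 m w g t - b g * F g t| <= eta).
    apply: whp_forall => g.
    apply: (whp_emp_cdf (x := fun m => p m g) (s := fun m => H m g)
      (F_cdf g) (b_gt0 g) _ _ (alt_cvg g) (weak_dep_alt g) eta0).
    - by move=> m i w; case/andP: (p01 m g i w).
    - by move=> m; rewrite (leq_trans _ (ms_le m g))// -[leqRHS](n_null_alt (H m g)) leq_addl.
  have wc : whp P (fun m w => forall g,
      (1 - eta) * (C * a g) <= c m w g <= (1 + eta) * (C * a g)).
    apply: whp_forall => g.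
    have pb0 : 0 < pibar g by rewrite pibarE mulr_gt0.
    have Ca : C * a g = piG g * pibar g by rewrite pibarE /a; ring.
    (* The relative error [eta] is split in halves: [r] bounds the error on [pihat], multiplied by a
       proportion at most 1, and [eta * piG g / 2] bounds the error on the proportion, multiplied by
       [pibar g]. *)
    pose r := eta * piG g * pibar g / 2.
    have r0 : 0 < r by rewrite !divr_gt0 ?mulr_gt0.
    have wp := whp_cvg_in_probability (fun m => measurable_funPT (pihat m g)) r0 (pihat_cvg g).
    apply: whpS wp; near=> m => w wpw.
    have : `|piG g - (ms m g)%:R / m%:R| <= eta * piG g / 2.
      near: m; move/cvgrPdist_le : (ms_cvg g); apply.
      by rewrite divr_gt0 ?mulr_gt0.
    have : (ms m g)%:R / m%:R <= 1 :> R.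
      have m0 : (0 < m)%N by near: m; exact: nbhs_infty_gt.
      by rewrite ler_pdivrMr ?ltr0n// mul1r ler_nat.
    have : 0 <= (ms m g)%:R / m%:R :> R by rewrite divr_ge0.
    rewrite /c Ca; move: wpw; rewrite /r.
    move: (_ / _) (pihat m g w) => q x; rewrite ltr_norml ler_norml.
    move=> /andP[x1 x2] q0 q1 /andP[q2 q3].
    have := piG_gt0 g; move: (piG g) (pibar g) pb0 x1 x2 q2 q3 => z y y0 x1 x2 q2 q3 z0.
    by apply/andP; split; nra.
  apply: whpS (whp_and w0 (whp_and w1 wc)); apply: nearW => m w [c0 [c1 cc]].
  by split=> //; move=> g t; exact: emp_cdf_ge0.
have power eps : 0 < eps -> whp P (fun m w =>
    `|m%:R^-1 * true_rejections R (H m) (MWBH_of Wstar m) w - l| <= eps /\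
    m%:R^-1 * true_rejections R (H m) (MWBH_of What m) w <= l + eps).
  move=> eps0.
  have [eta eta0 Heta] := power_close a_gt0 b_gt0 ab1 C_gt0 alpha_gt0 F_cdf sc eps0.
  apply: whpS (close _ eta0); near=> m => w /Heta cl.
  have m0 : (0 < m)%N by near: m; exact: nbhs_infty_gt.
  have := cl (Wstar m w) (fun u u01 => Wstar_K m w u m0 u01).
  rewrite /true_rejections /MWBH_of !true_rejections_emp => -[u v u01 vK|-> Hv].
    (* Pointwise maximality of [Ghat] over [Khat] is the optimality of [emp_total] required by
       [power_close]. *)
    rewrite -!Ghat_emp; have [_] := Wstar_max m w u m0 u01.
    move=> ub; rewrite [leLHS](_ : _ = Ghat m alpha (pval m w) (fun=> v) u).
      by apply: ub; exists v.
    by rewrite (Ghat_emp m alpha (pval m w) (H m)).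
  by split=> //; apply: Hv => u u01; exact: What_K.
have X01 (W : nat -> T -> R -> 'rV[R]_G) m w :
  0 <= m%:R^-1 * true_rejections R (H m) (MWBH_of W m) w <= 1.
  exact: true_rejections01.
have mX (W : nat -> T -> R -> 'rV[R]_G) :
  (forall m, (0 < m)%N -> measurable_fun setT (true_rejections R (H m) (MWBH_of W m))) ->
  \forall m \near \oo, measurable_fun setT
    (fun w => m%:R^-1 * true_rejections R (H m) (MWBH_of W m) w).
  move=> mW; near=> m; apply: measurable_funM => //; apply: mW.
  by near: m; exact: nbhs_infty_gt.
have PE (W : nat -> T -> R -> 'rV[R]_G) :
  (forall m, (0 < m)%N -> measurable_fun setT (true_rejections R (H m) (MWBH_of W m))) ->
  (fun m => Pow P m (H m) (MWBH_of W m)) = (fun m =>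
    \int[P]_w (m%:R^-1 * true_rejections R (H m) (MWBH_of W m) w)%:E)%E.
  by move=> mW; apply/funext => m; rewrite PowE//; exact: mW.
have us0 : 0 < oracle_level a b F C alpha by exact: oracle_level_gt0.
have l01 : 0 <= l <= 1.
  rewrite max_alts_le1 ?(ltW us0)// andbT -(max_alts0 a_gt0 b_gt0 ab1 C_gt0 alpha_gt0 F_cdf).
  by apply: max_alts_homo => //; exact: ltW.
exists l; rewrite !PE//; split.
  apply: (cvg_expectation (mX _ Wstar_meas) (X01 Wstar) l01) => eps eps_gt0.
  by apply: whpS (power _ eps_gt0); apply: nearW => m w [].
apply: (limn_esup_expectation_le (mX _ What_meas) (X01 What) l01) => eps eps_gt0.
by apply: whpS (power _ eps_gt0); apply: nearW => m w [].
Unshelve. all: by end_near. Qed.
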